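(* Let $(R,\mathcal{M})$ be a local ring. The following statements are equivalent: (1) Every ideal of $R$ is a direct sum of cyclic $R$-modules. (2) Every ideal of $R$ is a direct sum of cyclic $R$-modules, at most two of which are not simple. (3) There is an index set $\Lambda$ and a set of elements $\{x,y\}\cup\{w_\lambda\}_{\lambda\in\Lambda}\subseteq R$ such that $\mathcal{M}=Rx\oplus Ry\oplus\left(\bigoplus_{\lambda\in\Lambda}Rw_\lambda\right)$, where each $Rw_\lambda$ is a simple $R$-module and $R/\mathrm{Ann}(x)$, $R/\mathrm{Ann}(y)$ are principal ideal rings. (4) There is an index set $\Lambda$ such that every ideal $I$ of $R$ is of one of the following forms: (i) $I=Rx'\oplus Ry'\oplus\left(\bigoplus_{\gamma\in\Gamma}Rw'_\gamma\right)$, where $\Gamma$ is an index set with $|\Gamma|\le|\Lambda|$, the $Rw'_\gamma$ are simple $R$-modules, and $x',y'\in R$ are such that $R/\mathrm{Ann}(x')$ and $R/\mathrm{Ann}(y')$ are principal ideal rings; (ii) $I=Rz'\oplus\left(\bigoplus_{\gamma\in\Gamma}Rw'_\gamma\right)$, where $\Gamma$ is an index set with $|\Gamma|\le|\Lambda|$, the $Rw'_\gamma$ are simple $R$-modules, and $z'\in R$ is such that every ideal of $R/\mathrm{Ann}(z')$ is a direct sum of at most two principal ideals. (5) Every ideal of $R$ is a direct summand of a direct sum of cyclic $R$-modules. Moreover, the index sets $\Lambda$ in statements (3) and (4) are the same, and $|\Lambda|+2$ is a bound for the direct sum decompositions of all ideals of $R$.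
   Context: All rings are commutative with identity and all modules are unital. A ring is local if it has a unique maximal ideal (no Noetherian assumption); $(R,\mathcal{M})$ denotes a local ring with maximal ideal $\mathcal{M}$. For $a\in R$, $\mathrm{Ann}(a)=\{r\in R : ra=0\}$. A module is simple if it is nonzero and has no submodules except $(0)$ and itself. Direct sums of ideals contained in $R$ are internal. A principal ideal ring is a ring in which every ideal is principal (the zero ring is allowed). Index sets may be empty, and the elements $x,y,x',y',z'$ may be zero.
   Formalization: In (4) only proper ideals I are considered: for I = R the claim fails, e.g. in k[[x,y,w]]/(xy,xw,yw,w^2). ''The index sets are the same'' is read as: each Λ of (3) serves in (4), and each Λ of (4) has at least the cardinality of some Λ' of (3), since (4) is monotone in Λ. *)

(* Defs.v *)
From HB Require Import structures.
From mathcomp Require Import all_boot all_order all_algebra all_classical.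

Set Implicit Arguments.
Unset Strict Implicit.
Unset Printing Implicit Defensive.

Import GRing.Theory.

Local Open Scope ring_scope.
Local Open Scope classical_set_scope.
Local Open Scope card_scope.
Local Open Scope quotient_scope.

Section Modules.
Variables (R : pzRingType) (V : lmodType R).
Implicit Types (N D : set V) (m : V).

Definition submodule N : Prop := submod_closed [in N].

Definition cyclic m : set V := [set a *: m | a in [set: R]].

Definition simple N : Prop :=
  [/\ submodule N, N != [set 0]
    & forall N', submodule N' -> N' `<=` N -> N' = [set 0] \/ N' = N].

(* Elements of the external direct sum of the [N l]. *)
Definition finsupp_family (L : choiceType) (N : L -> set V) : set (L -> V) :=
  [set v | (forall l, N l (v l)) /\ finite_set [set l | v l != 0]].

(* [D] is the internal direct sum of the [N l]: the summation map from the
   external direct sum is a bijection onto [D].  Taking index types to be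
   [choiceType]s is no restriction, since classically every type is one. *)
Definition direct_sum (L : choiceType) (N : L -> set V) (D : set V) : Prop :=
  set_bij (finsupp_family N) D (fun v => \sum_(l \in [set: L]) v l).

Definition direct_sum_cyclic D : Prop :=
  exists (L : choiceType) (w : L -> V), direct_sum (fun l => cyclic (w l)) D.

(* A family is allowed to repeat submodules, so nonsimple summands are counted
   by their indices. *)
Definition direct_sum_cyclic_two_nonsimple D : Prop :=
  exists (L : choiceType) (w : L -> V),
    direct_sum (fun l => cyclic (w l)) D /\
    [set l | ~ simple (cyclic (w l))] #<= `I_2.

End Modules.

Definition isomorphic (R : pzRingType) (V W : lmodType R)
    (N : set V) (N' : set W) : Prop :=
  exists f : V -> W,
    set_bij N N' f /\
    forall a, {in N &, forall u v, f (a *: u + v) = a *: f u + f v}.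

Definition summand_of_direct_sum_cyclic (R : pzRingType) (V : lmodType R)
    (D : set V) : Prop :=
  exists (W : lmodType R) (N N' : set W),
    [/\ direct_sum_cyclic [set: W], submodule N, submodule N',
        direct_sum (fun b : bool => if b then N else N') [set: W]
      & isomorphic D N].

Section Rings.
Variable R : comPzRingType.
Implicit Types I J : set R^o.

Definition ideal I : Prop := submodule I.

Definition maximal_ideal I : Prop :=
  [/\ ideal I, I != [set: R^o]
    & forall J, ideal J -> I `<=` J -> J = I \/ J = [set: R^o]].

Definition local_ring_with (M : set R^o) : Prop :=
  maximal_ideal M /\ forall J, maximal_ideal J -> J = M.

Definition principal_ideal_ring : Prop :=
  forall I, ideal I -> exists a : R^o, I = cyclic a.

Definition ideals_sum_two_principal : Prop :=
  forall I, ideal I -> exists (n : nat) (c : 'I_n -> R^o),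
    (n <= 2)%N /\ direct_sum (fun i => cyclic (c i)) I.

End Rings.

Arguments principal_ideal_ring R : clear implicits.
Arguments ideals_sum_two_principal R : clear implicits.

Section AnnQuotient.
Variables (R : comPzRingType) (x : R).

Definition Ann : {pred R} := [pred r | r * x == 0].

Lemma Ann_zmod_closed : zmod_closed Ann.
Proof.
split=> [|r s]; rewrite !inE ?mul0r //.
by move=> /eqP r0 /eqP s0; rewrite mulrBl r0 s0 subr0.
Qed.

HB.instance Definition _ := GRing.isZmodClosed.Build R Ann Ann_zmod_closed.

(* [R / Ann x].  [{ideal_quot _}] has a ring structure only for proper ideals,
   while [x = 0] gives the zero ring here. *)
Definition quot_Ann : Type := {ideal_quot Ann}.

HB.instance Definition _ := GRing.Zmodule.on quot_Ann.

Definition quot_Ann_one : quot_Ann := \pi_{ideal_quot Ann} 1.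
Definition quot_Ann_mul (a b : quot_Ann) : quot_Ann :=
  \pi_{ideal_quot Ann} (repr (a : {ideal_quot Ann}) * repr (b : {ideal_quot Ann})).

Lemma pi_quot_Ann_mul (r s : R) :
  quot_Ann_mul (\pi_{ideal_quot Ann} r) (\pi_{ideal_quot Ann} s) = \pi_{ideal_quot Ann} (r * s).
Proof.
have AnnM (a b : R) : b \in Ann -> a * b \in Ann.
  by rewrite !inE => /eqP b0; rewrite -mulrA b0 mulr0.
apply/eqP; rewrite -Quotient.idealrBE.
set r' := repr _; set s' := repr _.
have -> : r' * s' - r * s = s' * (r' - r) + r * (s' - s).
  by rewrite !mulrBr (mulrC s' r') (mulrC s' r) addrA subrK.
by rewrite rpredD // AnnM // Quotient.idealrBE reprK.
Qed.

Lemma pi_quot_Ann_add (r s : R) :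
  (\pi_{ideal_quot Ann} r : quot_Ann) + \pi_{ideal_quot Ann} s
  = \pi_{ideal_quot Ann} (r + s).
Proof. by rewrite [RHS]Quotient.pi_add. Qed.

Fact quot_Ann_mulA : associative quot_Ann_mul.
Proof.
move=> a b c; rewrite -[a](@reprK _ {ideal_quot Ann}) -[b](@reprK _ {ideal_quot Ann}).
by rewrite -[c](@reprK _ {ideal_quot Ann}) !pi_quot_Ann_mul mulrA.
Qed.

Fact quot_Ann_mulC : commutative quot_Ann_mul.
Proof. by move=> a b; rewrite /quot_Ann_mul mulrC. Qed.

Fact quot_Ann_mul1 : left_id quot_Ann_one quot_Ann_mul.
Proof.
by move=> a; rewrite -[a](@reprK _ {ideal_quot Ann}) pi_quot_Ann_mul mul1r.
Qed.

Fact quot_Ann_mulDl : left_distributive quot_Ann_mul +%R.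
Proof.
move=> a b c; rewrite -[a](@reprK _ {ideal_quot Ann}) -[b](@reprK _ {ideal_quot Ann}).
rewrite -[c](@reprK _ {ideal_quot Ann}).
by rewrite pi_quot_Ann_add !pi_quot_Ann_mul pi_quot_Ann_add mulrDl.
Qed.

HB.instance Definition _ := GRing.Zmodule_isComPzRing.Build quot_Ann
  quot_Ann_mulA quot_Ann_mulC quot_Ann_mul1 quot_Ann_mulDl.

End AnnQuotient.

Section Decompositions.
Variable R : comPzRingType.
Implicit Types (M I : set R^o) (x y z : R^o).

(* [I = R x (+) R y (+) (+)_l R (w l)], indexed by [option (option L)]. *)
Definition sum_two_and_simple (L : choiceType) I x y (w : L -> R^o) : Prop :=
  direct_sum (fun i => cyclic (oapp (oapp w y) x i)) I /\
  forall l, simple (cyclic (w l)).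

(* [I = R z (+) (+)_l R (w l)], indexed by [option L]. *)
Definition sum_one_and_simple (L : choiceType) I z (w : L -> R^o) : Prop :=
  direct_sum (fun i => cyclic (oapp w z i)) I /\
  forall l, simple (cyclic (w l)).

Definition two_PIR_form (L : choiceType) I : Prop :=
  exists (x y : R^o) (w : L -> R^o),
    [/\ sum_two_and_simple I x y w, principal_ideal_ring (quot_Ann x)
      & principal_ideal_ring (quot_Ann y)].

Definition one_generator_form (L : choiceType) I : Prop :=
  exists (z : R^o) (w : L -> R^o),
    sum_one_and_simple I z w /\ ideals_sum_two_principal (quot_Ann z).

(* Only proper ideals are considered.  The unit ideal is indecomposable when
   [R] is local, so it has one of the two forms only if every ideal of [R] is
   a direct sum of at most two principal ideals; this fails already in
   k[[x,y,w]]/(xy,xw,yw,w^2), whose maximal ideal is Rx (+) Ry (+) Rw with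
   Rw simple and R/Ann(x), R/Ann(y) principal ideal rings. *)
Definition proper_ideals_form (L : choiceType) : Prop :=
  forall I, ideal I -> I != [set: R^o] ->
    exists G : choiceType,
      [set: G] #<= [set: L] /\ (two_PIR_form G I \/ one_generator_form G I).

(* [|L| + 2] bounds the number of nonzero summands in every decomposition of
   every ideal. *)
Definition decompositions_bounded (L : choiceType) : Prop :=
  forall I, ideal I ->
  forall (G : choiceType) (N : G -> set R^o),
    (forall g, ideal (N g)) -> (forall g, N g != [set 0]) ->
    direct_sum N I -> [set: G] #<= [set: option (option L)].

End Decompositions.

Arguments proper_ideals_form R L : clear implicits.
Arguments decompositions_bounded R L : clear implicits.

(* Main.v *)
(* Statement (5) is used as follows.  By Azumaya's exchange argument over a local
   ring, an ideal I with m I <> 0 that is a direct summand of a direct sum of cyclic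
   modules has a cyclic direct summand R a with m a <> 0.  Splitting such
   summands off M leaves, after at most two steps, a semisimple ideal: if
   x, y, z are pairwise orthogonal with nonzero squares, the ideal
   (x + y, x + z) has no such decomposition.  Moreover R z is uniserial for each
   nonsimple summand, since the intersection of the R z^k is divisible by z.
   Conversely let M = R x (+) R y (+) S with S semisimple, and let g, h generate
   the projections of I <= M to R x, R y.  Either I contains g + s and h + t with
   s, t in S, and I = R(g + s) (+) R(h + t) (+) (I cap S), or
   I = R n (+) (I cap S) for any n in I whose x-component is g.  Cardinal bounds
   come from Steinitz exchange against the uniform summands of M. *)

Require Import Defs.
From HB Require Import structures.
From mathcomp Require Import all_boot all_order all_algebra all_classical ring.

Set Implicit Arguments.
Unset Strict Implicit.
Unset Printing Implicit Defensive.

Import GRing.Theory.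

Local Open Scope ring_scope.
Local Open Scope classical_set_scope.
Local Open Scope card_scope.
Local Open Scope quotient_scope.

(** No finiteness is available: families may be infinite, and Krull's intersection theorem cannot be
    invoked. Direct sums are therefore read as a span together with independence, a form in which
    members can be exchanged one at a time under Zorn's lemma, and R/Ann(x) is read on the
    isomorphic module R x. Nonsimple summands have nonzero square for the following reason. Elements
    of complementary ideals multiply to zero, since the product lies in both; so if M is the direct
    sum of R z and T, then M z = R z^2, and m z <> 0 for some m in M forces z^2 <> 0. The equality M
    z = R z^2 also drives the argument with the powers of z. The ideal (x + y, x + z) is excluded
    because multiplication by x, y, z reads off the coefficients al + be, al, be of a generator al
    (x + y) + be (x + z) of a cyclic summand; once al or be is a unit, some coordinate produces a
    nonzero element common to the summand and its complement. Form (ii) of (4), applied to M, leads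
    back to (3) because the condition on R/Ann(z) supplies the cyclic summands that the power
    argument consumes. *)

Section Submodules.
Variables (R : comPzRingType) (V : lmodType R).
Implicit Types (A B D N P : set V) (u v w : V) (a b r : R).

Lemma submoduleP N :
  submodule N <-> N 0 /\ forall a u v, N u -> N v -> N (a *: u + v).
Proof.
split=> -[N0 ND]; split.
- by move: N0; rewrite !inE.
- by move=> a u v Nu Nv; have := ND a u v; rewrite !inE; apply.
- by rewrite !inE.
- by move=> a u v; rewrite !inE; exact: ND.
Qed.

Section Closure.
Variables (N : set V) (hN : submodule N).

Lemma submod0 : N 0. Proof. by have [] := (submoduleP N).1 hN. Qed.

Lemma submodD u v : N u -> N v -> N (u + v).
Proof.
move=> Nu Nv; have [_ /(_ 1 u v Nu Nv)] := (submoduleP N).1 hN.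
by rewrite scale1r.
Qed.

Lemma submodZ a u : N u -> N (a *: u).
Proof.
move=> Nu; have [_ /(_ a u 0 Nu submod0)] := (submoduleP N).1 hN.
by rewrite addr0.
Qed.

Lemma submodN u : N u -> N (- u).
Proof. by move=> Nu; rewrite -scaleN1r; apply: submodZ. Qed.

Lemma submodB u v : N u -> N v -> N (u - v).
Proof. by move=> Nu Nv; apply: submodD => //; apply: submodN. Qed.

Lemma submod_sum (L : eqType) (s : seq L) (F : L -> V) :
  {in s, forall l, N (F l)} -> N (\sum_(l <- s) F l).
Proof.
move=> NF; rewrite big_seq_cond; apply: (big_ind N) => //.
- exact: submod0.
- exact: submodD.
- by move=> l /andP[/NF].
Qed.

End Closure.

Lemma submodule_set0 : submodule [set (0 : V)].
Proof. by apply/submoduleP; split=> // a u v -> ->; rewrite scaler0 addr0. Qed.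

Lemma submodule_setT : submodule [set: V].
Proof. by apply/submoduleP. Qed.

Lemma submoduleI A B : submodule A -> submodule B -> submodule (A `&` B).
Proof.
move=> hA hB; apply/submoduleP; split; first by split; apply: submod0.
by move=> a u v [Au Bu] [Av Bv]; split; apply: submodD => //; apply: submodZ.
Qed.

Lemma submodule_cyclic w : submodule (cyclic w).
Proof.
apply/submoduleP; split; first by exists 0; rewrite ?scale0r.
by move=> a u v [b _ <-] [c _ <-]; exists (a * b + c); rewrite ?scalerDl ?scalerA.
Qed.

Lemma cyclic_sub N w : submodule N -> N w -> cyclic w `<=` N.
Proof. by move=> hN Nw _ [a _ <-]; apply: submodZ. Qed.

Lemma cyclic_id w : cyclic w w.
Proof. by exists 1; rewrite ?scale1r. Qed.

Lemma cyclicZ a w : cyclic w (a *: w).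
Proof. by exists a. Qed.

Lemma cyclic0 : cyclic (0 : V) = [set 0].
Proof.
apply/seteqP; split=> [_ [a _ <-]|_ ->]; first by rewrite scaler0.
exact: cyclic_id.
Qed.

(** * Spans, internal sums and independence *)

Definition span A : set V := [set v | forall P, submodule P -> A `<=` P -> P v].

Lemma span_submodule A : submodule (span A).
Proof.
apply/submoduleP; split=> [P hP _|a u v Au Av P hP AP]; first exact: submod0.
by apply: (submodD hP); [apply: submodZ => //; apply: Au|apply: Av].
Qed.

Lemma sub_span A : A `<=` span A.
Proof. by move=> v Av P _; apply. Qed.

Lemma span_sub A P : submodule P -> A `<=` P -> span A `<=` P.
Proof. by move=> hP AP v; apply. Qed.

Lemma spanS A B : A `<=` B -> span A `<=` span B.
Proof.
by move=> AB; apply: span_sub (span_submodule _) _ => v /AB; apply: sub_span.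
Qed.

Lemma span_id N : submodule N -> span N = N.
Proof. by move=> hN; apply/seteqP; split; [exact: span_sub|exact: sub_span]. Qed.

Lemma span0 : span set0 = [set (0 : V)].
Proof.
apply/seteqP; split; first by apply: span_sub => //; apply: submodule_set0.
by move=> _ -> P hP _; apply: submod0.
Qed.

Definition isum A B D : Prop :=
  [/\ A `<=` D, B `<=` D, forall d, D d -> exists u v, [/\ A u, B v & d = u + v]
    & forall v, A v -> B v -> v = 0].

Definition msum A B : set V := [set u + v | u in A & v in B].

Lemma submodule_msum A B : submodule A -> submodule B -> submodule (msum A B).
Proof.
move=> hA hB; apply/submoduleP; split.
  by exists 0; [exact: submod0|exists 0; [exact: submod0|rewrite addr0]].
move=> a _ _ [u Au [v Bv <-]] [u' Au' [v' Bv' <-]].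
exists (a *: u + u'); first by apply: submodD => //; apply: submodZ.
exists (a *: v + v'); first by apply: submodD => //; apply: submodZ.
by rewrite scalerDr addrACA.
Qed.

Lemma msuml A B u : submodule B -> A u -> msum A B u.
Proof. by move=> hB Au; exists u => //; exists 0; [exact: submod0|rewrite addr0]. Qed.

Lemma msumr A B u : submodule A -> B u -> msum A B u.
Proof. by move=> hA Bu; exists 0; [exact: submod0|exists u => //; rewrite add0r]. Qed.

Lemma isumP A B D : submodule A -> submodule B -> submodule D ->
  isum A B D <-> D = msum A B /\ forall v, A v -> B v -> v = 0.
Proof.
move=> hA hB hD; split=> [[AD BD DAB AB0]|[-> AB0]].
  split=> //; apply/seteqP; split=> [d /DAB[u [v [Au Bv ->]]]|_ [u Au [v Bv <-]]].
    by exists u => //; exists v.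
  by apply: submodD => //; [exact: AD|exact: BD].
split=> //; [by move=> u; apply: msuml|by move=> u; apply: msumr|].
by move=> _ [u Au [v Bv <-]]; exists u, v.
Qed.

Lemma msum_span A B : span (A `|` B) = msum (span A) (span B).
Proof.
have hA := span_submodule A; have hB := span_submodule B.
apply/seteqP; split.
  apply: span_sub; first exact: submodule_msum.
  by move=> v [Av|Bv]; [apply: msuml hB _|apply: msumr hA _]; apply: sub_span.
move=> _ [u Au [v Bv <-]]; apply: (submodD (span_submodule _)).
  exact: spanS Au.
exact: spanS Bv.
Qed.

(** The right-hand side is already a submodule, since two links of a chain lie in the larger one.
    [A] is kept apart because the chain may be empty, and then only [span A] remains. *)
Lemma span_chain (F : set (set V)) A : total_on F subset ->
  span ((\bigcup_(X in F) X) `|` A)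
  `<=` span A `|` \bigcup_(X in F) span (X `|` A).
Proof.
have hS := span_submodule; move=> totF.
have Xmax X Y : F X -> F Y -> exists Z, [/\ F Z, X `<=` Z & Y `<=` Z].
  by move=> FX FY; case: (totF X Y FX FY) => XY; [exists Y; split|exists X; split].
apply: span_sub.
  apply/submoduleP; split; first by left; exact: submod0 (span_submodule _).
  have AX X : span A `<=` span (X `|` A) by apply: spanS; apply: subsetUr.
  have cl a u v X : span (X `|` A) u -> span (X `|` A) v ->
      span (X `|` A) (a *: u + v).
    by move=> Xu Xv; apply: (submodD (hS _)) => //; apply: (submodZ (hS _)).
  move=> a u v [Au|[X FX Xu]] [Av|[Y FY Yv]].
  - by left; apply: (submodD (hS _)) => //; apply: (submodZ (hS _)).
  - by right; exists Y => //; apply: cl => //; apply: AX.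
  - by right; exists X => //; apply: cl => //; apply: AX.
  - have [Z [FZ XZ YZ]] := Xmax X Y FX FY; right; exists Z => //.
    by apply: cl; [apply: spanS Xu|apply: spanS Yv]; apply: setSU.
move=> v [[X FX Xv]|Av]; last by left; apply: sub_span.
by right; exists X => //; apply: sub_span; left.
Qed.

Definition indep (L : Type) (N : L -> set V) : Prop :=
  forall l v, N l v -> span (\bigcup_(k in [set k | k <> l]) N k) v -> v = 0.

Lemma span_bigcup_sub (L : Type) (K : set L) (N : L -> set V) P :
  submodule P -> (forall k, K k -> N k `<=` P) ->
  span (\bigcup_(k in K) N k) `<=` P.
Proof. by move=> hP NP; apply: span_sub => // v [k Kk /NP]; apply. Qed.

Lemma span_bigcup_mem (L : Type) (K : set L) (N : L -> set V) k :
  K k -> N k `<=` span (\bigcup_(k in K) N k).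
Proof. by move=> Kk v Nv; apply: sub_span; exists k. Qed.

Lemma span_bigcupS (L : Type) (K K' : set L) (N N' : L -> set V) :
  (forall k, K k -> K' k) -> (forall k, K k -> N k `<=` N' k) ->
  span (\bigcup_(k in K) N k) `<=` span (\bigcup_(k in K') N' k).
Proof. by move=> KK NN; apply: spanS => v [k Kk Nv]; exists k; [exact: KK|exact: NN]. Qed.

Lemma span_bigcupSl (L : Type) (K K' : set L) (N : L -> set V) :
  K `<=` K' -> span (\bigcup_(k in K) N k) `<=` span (\bigcup_(k in K') N k).
Proof. by move=> KK; apply: span_bigcupS => // k _ v. Qed.

Lemma span_bigcupD1 (L : Type) (K : set L) (N : L -> set V) i :
  submodule (N i) ->
  span (\bigcup_(k in K) N k)
  `<=` msum (N i) (span (\bigcup_(k in [set k | K k /\ k <> i]) N k)).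
Proof.
move=> hi; apply: span_bigcup_sub.
  exact: submodule_msum hi (span_submodule _).
move=> k Kk v Nv; have [ki|ki] := pselect (k = i).
  by apply: msuml; [exact: span_submodule|rewrite -ki].
by apply: msumr => //; apply: span_bigcup_mem Nv.
Qed.

Section Sums.
Variable L : choiceType.
Implicit Types (K : set L).

(** Any finite [E] containing the support will do, so families with different supports can be added
    over one common [E]. *)
Lemma fsum_seq (E : set L) (x : L -> V) : finite_set E ->
  (forall l, ~ E l -> x l = 0) ->
  \sum_(l \in [set: L]) x l = \sum_(l <- finmap.enum_fset (fset_set E)) x l.
Proof.
move=> finE x0; apply: fsbigTE => l; rewrite in_fset_set // => /negP lE.
by apply: x0 => /mem_set.
Qed.

Lemma fsum1 (l : L) v : \sum_(k \in [set: L]) (if k == l then v else 0) = v.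
Proof.
rewrite (@fsum_seq [set l]) //; last first.
  by move=> k /eqP/negPf ->.
by rewrite fset_set1 finmap.big_seq_fset1 eqxx.
Qed.

Definition supported (N : L -> set V) K : set (L -> V) :=
  [set x | finsupp_family N x /\ forall l, ~ K l -> x l = 0].

(** Links the span, an intersection of submodules, to concrete finite sums: the latter form a
    submodule containing every [N k]. *)
Lemma span_supported (N : L -> set V) K : (forall l, submodule (N l)) ->
  span (\bigcup_(k in K) N k)
  = [set \sum_(l \in [set: L]) x l | x in supported N K].
Proof.
move=> hN; apply/seteqP; split.
  apply: span_bigcup_sub.
    apply/submoduleP; split.
      exists (fun=> 0); last by rewrite fsbig1.
      split=> //; split; first by move=> l; apply: submod0.
      by rewrite (_ : [set _ | _] = set0) // -subset0 => l /= /eqP[].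
    move=> a _ _ [x [[Nx fx] xK] <-] [y [[Ny fy] yK] <-].
    pose E := [set l | x l != 0] `|` [set l | y l != 0].
    have finE : finite_set E by rewrite finite_setU.
    have xE l : ~ E l -> x l = 0 by move/not_orP => [/negP/negbNE/eqP].
    have yE l : ~ E l -> y l = 0 by move/not_orP => [_ /negP/negbNE/eqP].
    have xyE l : ~ E l -> a *: x l + y l = 0.
      by move=> El; rewrite xE // yE // scaler0 addr0.
    exists (fun l => a *: x l + y l); last first.
      by rewrite !(fsum_seq finE) // scaler_sumr big_split.
    split; last by move=> l Kl; rewrite xK // yK // scaler0 addr0.
    split=> [l|]; first by apply: submodD => //; apply: submodZ.
    apply: sub_finite_set finE => l /= /eqP xyl.
    by apply: contrapT => /xyE.
  move=> k Kk v Nv; exists (fun l => if l == k then v else 0); last exact: fsum1.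
  split; last by move=> l; case: eqP => [->|].
  split=> [l|]; first by case: eqP => [->|_] //; apply: submod0.
  by apply: sub_finite_set (finite_set1 k) => l /=; case: (l =P k) => // _ /eqP[].
move=> _ [x [[Nx fx] xK] <-].
rewrite (@fsum_seq [set l | x l != 0]) //; last by move=> l /negP/negbNE/eqP.
apply: (submod_sum (span_submodule _)).
move=> l _; have [Kl|/xK ->] := pselect (K l); first exact: span_bigcup_mem (Nx l).
by apply: (submod0 (span_submodule _)).
Qed.

(** Injectivity of the summation map amounts to independence: if two families have the same sum,
    entry [l] of their difference is minus the sum of its other entries, hence zero. *)
Lemma direct_sumP (N : L -> set V) D : (forall l, submodule (N l)) ->
  direct_sum N D <-> D = span (\bigcup_(l in [set: L]) N l) /\ indep N.
Proof.
move=> hN; have eqS : supported N [set: L] = finsupp_family N.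
  by apply/seteqP; split=> [x []|x Nx] //; split=> // l /(_ I).
have finsum x y : finsupp_family N x -> finsupp_family N y ->
    finsupp_family N (fun l => x l - y l)
    /\ \sum_(l \in [set: L]) (x l - y l)
       = \sum_(l \in [set: L]) x l - \sum_(l \in [set: L]) y l.
  move=> [Nx fx] [Ny fy]; pose E := [set l | x l != 0] `|` [set l | y l != 0].
  have finE : finite_set E by rewrite finite_setU.
  have xE l : ~ E l -> x l = 0 by move/not_orP => [/negP/negbNE/eqP].
  have yE l : ~ E l -> y l = 0 by move/not_orP => [_ /negP/negbNE/eqP].
  have xyE l : ~ E l -> x l - y l = 0 by move=> El; rewrite xE // yE // subr0.
  split; last by rewrite !(fsum_seq finE) // sumrB.
  split=> [l|]; first exact: submodB.
  by apply: sub_finite_set finE => l /= /eqP xyl; apply: contrapT => /xyE.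
split.
  move=> [fD injD surjD]; split.
    rewrite span_supported // eqS; apply/seteqP; split.
      by move=> d /surjD[x Nx <-]; exists x.
    by move=> _ [x Nx <-]; apply: fD.
  move=> l v Nv; rewrite span_supported // => -[x [Nx xl] xv].
  have: x = (fun k => if k == l then v else 0).
    apply: injD; rewrite ?inE //; last by rewrite fsum1.
    split=> [k|]; first by case: eqP => [->|_] //; apply: submod0.
    by apply: sub_finite_set (finite_set1 l) => k /=; case: (k =P l) => // _ /eqP[].
  by move=> /(congr1 (fun f => f l)); rewrite eqxx => <-; apply: xl.
move=> [-> indN]; rewrite span_supported // eqS; split.
- by move=> x Nx; exists x.
- move=> x y; rewrite !inE => Nx Ny xy; apply/funext => l.
  have [Nz] := finsum _ _ Nx Ny; rewrite xy subrr; set z := fun l => x l - y l.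
  move=> z0; have [Nzl fz] := Nz; suff: z l = 0 by move/eqP; rewrite subr_eq0 => /eqP.
  apply: (indN l) => //; rewrite -[z l]opprK; apply: (submodN (span_submodule _)).
  rewrite span_supported //.
  have N1 : finsupp_family N (fun k => if k == l then z l else 0).
    split=> [k|]; first by case: eqP => [->|_] //; apply: submod0.
    by apply: sub_finite_set (finite_set1 l) => k /=; case: (k =P l) => // _ /eqP[].
  have [Ny' sumy'] := finsum _ _ Nz N1.
  exists (fun k => z k - (if k == l then z l else 0)).
    by split=> // k /= /contrapT ->; rewrite eqxx subrr.
  by rewrite sumy' z0 fsum1 sub0r.
- by move=> _ [x Nx <-]; exists x.
Qed.

End Sums.

End Submodules.

Lemma card_le_injective (A B : Type) (X : set A) (Y : set B) (f : A -> B) :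
  set_fun X Y f -> set_inj X f -> X #<= Y.
Proof.
move=> Yf injf; have [|g] := (@injfunPex A B X Y).2; first by exists f.
exact: inj_card_le g.
Qed.

(** * Exchange in independent families and comparison of cardinals *)

Section Independence.
Variables (R : comPzRingType) (V : lmodType R).
Implicit Types (A B D P T : set V) (u v w : V) (a r : R).
Local Notation span := (@span R V).
Let hS := @span_submodule R V.

Lemma direct_sum_submodule (L : choiceType) (N : L -> set V) D :
  (forall l, submodule (N l)) -> direct_sum N D -> submodule D.
Proof. by move=> hN /(direct_sumP _ hN)[-> _]. Qed.

Lemma indep_isum (L : Type) (N : L -> set V) l : (forall k, submodule (N k)) ->
  indep N ->
  isum (N l) (span (\bigcup_(k in [set k | k <> l]) N k))
    (span (\bigcup_(k in [set: L]) N k)).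
Proof.
move=> hN indN; split.
- exact: span_bigcup_mem.
- exact: span_bigcupSl.
- move=> d /(span_bigcupD1 (hN l))[u Nu [v Nv <-]]; exists u, v; split => //.
  by move: Nv; apply: span_bigcupSl => k [].
- exact: indN.
Qed.

Lemma direct_sum_isum (L : choiceType) (N : L -> set V) D l :
  (forall k, submodule (N k)) -> direct_sum N D ->
  isum (N l) (span (\bigcup_(k in [set k | k <> l]) N k)) D.
Proof. by move=> hN /(direct_sumP _ hN)[-> indN]; apply: indep_isum. Qed.

(** Peels off the summand at [None]; used twice, it opens the nested [option] index of the
    decompositions. *)
Lemma direct_sum_option (L : choiceType) (N : option L -> set V) D :
  (forall l, submodule (N l)) -> submodule D ->
  direct_sum N D
  <-> exists T, direct_sum (fun l => N (Some l)) T /\ isum (N None) T D.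
Proof.
move=> hN hD; have hN' l := hN (Some l).
have eqN : \bigcup_(k in [set k | k <> None]) N k
           = \bigcup_(l in [set: L]) N (Some l).
  apply/seteqP; split=> [v [[l|//] _ Nv]|v [l _ Nv]]; first by exists l.
  by exists (Some l).
split=> [NT|[T [/(direct_sumP _ hN')[-> indN]]]].
  exists (span (\bigcup_(l in [set: L]) N (Some l))); split.
    apply/direct_sumP => //; split=> // l v Nv Sv.
    have [_ indN] := (direct_sumP _ hN).1 NT; apply: indN Nv _.
    move: Sv; apply: span_bigcup_sub => // k kl.
    by apply: span_bigcup_mem => -[].
  by have := direct_sum_isum None hN NT; rewrite eqN.
move=> sumD; have [ND TD dD N0] := sumD.
apply/direct_sumP => //; split.
  apply/seteqP; split=> [_ /dD[u [v [Nu Tv ->]]]|].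
    apply: (submodD (hS _)); first exact: span_bigcup_mem Nu.
    move: Tv; rewrite -eqN; exact: span_bigcupSl.
  apply: span_bigcup_sub => // -[l|] _ //.
  by move=> v Nv; apply: TD; apply: span_bigcup_mem Nv.
move=> [l|] v Nv; last by rewrite eqN; apply: N0.
move=> /(span_bigcupD1 (hN None))[u Nu [t Tt utv]].
have Tt' : span (\bigcup_(k in [set k | k <> l]) N (Some k)) t.
  move: Tt; apply: span_bigcup_sub => // -[k|] [kl kN]; last by case: kN.
  apply: (@span_bigcup_mem _ _ _ _ (fun l => N (Some l))) => kl'.
  by apply: kl; rewrite kl'.
have u0 : u = 0.
  apply: N0 => //; have -> : u = v - t by rewrite -utv addrK.
  apply: (submodB (hS _)); first exact: span_bigcup_mem Nv.
  move: Tt'; exact: span_bigcupSl.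
by apply: indN Nv _; rewrite -utv u0 add0r.
Qed.

(** Only the new member needs a check. In a relation at another index, its contribution [u] is a
    difference of elements of the remaining members, so [u = 0] and the relation was one of the old
    family. *)
Lemma indep_replace (L : Type) (N N' : L -> set V) i :
  submodule (N' i) -> indep N -> (forall k, k <> i -> N' k `<=` N k) ->
  (forall v, N' i v -> span (\bigcup_(k in [set k | k <> i]) N k) v -> v = 0) ->
  indep N'.
Proof.
move=> hN' indN N'N N'0 l v N'v Sv; have [li|li] := pselect (l = i).
  apply: N'0; first by rewrite -li.
  by move: Sv; rewrite li; apply: span_bigcupS => // k /N'N.
have li' : i <> l by move=> il; apply: li.
have [u N'u [t Tt utv]] := span_bigcupD1 hN' Sv.
have u0 : u = 0.
  apply: N'0 => //; have -> : u = v - t by rewrite -utv addrK.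
  apply: (submodB (hS _)); first by apply: span_bigcup_mem (N'N _ li _ N'v).
  by move: Tt; apply: span_bigcupS => k [_ ki] //; apply: N'N.
apply: indN (N'N _ li _ N'v) _; rewrite -utv u0 add0r.
by move: Tt; apply: span_bigcupS => k [kl ki] //; apply: N'N.
Qed.

(** Every scalar kills [T] or is invertible, so [T] behaves like a vector space over the residue
    field, and a maximal free subset is a basis with simple lines. *)
Lemma semisimple_basis T : submodule T ->
  (forall r, (forall v, T v -> r *: v = 0) \/ exists s, s * r = 1) ->
  exists (L : choiceType) (w : L -> V),
    direct_sum (fun l => cyclic (w l)) T /\ forall l, simple (cyclic (w l)).
Proof.
move=> hT unitT.
pose free (B : set V) := B `<=` T /\ forall b : V, B b -> ~ span (B `\ b) b.
have [F freeF totF|B [[BT freeB] maxB]] := @Zorn_bigcup V free.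
  split=> [v [X FX Xv]|b [X FX Xb]]; first by have [XT _] := freeF _ FX; apply: XT.
  pose F' := [set Y `\ b | Y in F].
  have totF' : total_on F' subset.
    move=> _ _ [Y FY <-] [Z FZ <-].
    by have [YZ|ZY] := totF Y Z FY FZ; [left|right]; apply: setSD.
  have sub : (\bigcup_(Y in F) Y) `\ b `<=` (\bigcup_(Y in F') Y) `|` set0.
    move=> v [[Y FY Yv] vb]; left; exists (Y `\ b) => //; by exists Y.
  move=> /(spanS sub)/(span_chain totF')[|[_ [Y FY <-]]].
    rewrite span0 => b0; have [_ /(_ b Xb)] := freeF _ FX; apply.
    by rewrite b0; apply: (submod0 (hS _)).
  rewrite setU0; have [XY|YX] := totF X Y FX FY.
    by have [_ /(_ b (XY _ Xb))] := freeF _ FY.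
  by move=> /(spanS (@setSD _ [set b] _ _ YX)); have [_ /(_ b Xb)] := freeF _ FX.
(* Freeness only keeps [b] itself out of the span of the others. Dividing by unit coefficients
   extends this to all multiples, as independence of the cyclic modules requires. *)
have ZB (b : V) r : B b -> span (B `\ b) (r *: b) -> r *: b = 0.
  move=> Bb Sb; have [|[s sr]] := unitT r; first by apply; apply: BT.
  have := submodZ (hS _) s Sb; rewrite scalerA sr scale1r.
  by move=> /(freeB _ Bb).
have spanB : span B = T.
  apply/seteqP; split; first exact: span_sub.
  move=> v Tv; apply: contrapT => Bv.
  apply: (maxB (B `|` [set v])).
    split; first by apply: subsetUl.
    by move=> sub; apply: Bv; apply: sub_span; apply: sub; right.
  split=> [_ [/BT //|-> //]|b [Bb|->]]; last first.
    by move=> Sv; apply: Bv; apply: spanS Sv => u [[//|-> /(_ erefl)]].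
  have bv : b <> v by move=> bv; apply: Bv; rewrite -bv; apply: sub_span.
  have -> : (B `|` [set v]) `\ b = (B `\ b) `|` [set v].
    apply/seteqP; split=> [u [[Bu|->] ub]|u [[Bu ub]|->]].
    - by left.
    - by right.
    - by split=> //; left.
    - by split; [right|move=> /esym].
  rewrite msum_span => -[t St [u Su tub]].
  have [r _ ur] : cyclic v u.
    by apply: span_sub Su => [|_ ->]; [exact: submodule_cyclic|exact: cyclic_id].
  have [rT|[s sr]] := unitT r.
    have bt : b = t by rewrite -tub -ur rT // addr0.
    by apply: (freeB b Bb); rewrite [X in span _ X]bt.
  apply: Bv; have -> : v = s *: (b - t).
    by rewrite -tub addrC addKr -ur scalerA sr scale1r.
  apply: (submodZ (hS _)); apply: (submodB (hS _)); first exact: sub_span.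
  by move: St; apply: spanS => x [].
exists (set_type B), (fun x => val x).
have hC (l : set_type B) := submodule_cyclic (val l).
split.
  apply/direct_sumP => //; split.
    rewrite -spanB; apply/seteqP; split.
      apply: (span_sub (hS _)) => b Bb; apply: sub_span.
      exists (exist _ b (mem_set Bb)) => //; exact: cyclic_id.
    apply: span_bigcup_sub => // x _; apply: cyclic_sub => //.
    by apply: sub_span; apply: set_valP.
  move=> x _ [r _ <-] Sx; apply: ZB; first exact: set_valP.
  move: Sx; apply: span_bigcup_sub => // y yx; apply: cyclic_sub => //.
  apply: sub_span; split; first exact: set_valP.
  by move=> /= /val_inj.
move=> x; have Bx : B (val x) by apply: set_valP.
split=> //.
  apply/eqP => x0; apply: (freeB _ Bx).
  have -> : val x = 0 by have := cyclic_id (val x); rewrite x0.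
  exact: (submod0 (hS _)).
move=> N hN Nx; have [N0|] := pselect (N = [set 0]); first by left.
move=> N0; right; apply/seteqP; split=> //; apply: cyclic_sub => //.
have [v [Nv v0]] : exists v, N v /\ v <> 0.
  apply: contrapT => no; apply: N0; apply/seteqP; split=> [v Nv|_ ->].
    by apply: contrapT => v0; apply: no; exists v.
  exact: submod0.
have [r _ rv] := Nx _ Nv; have [rT|[s sr]] := unitT r.
  by case: v0; rewrite -rv rT //; apply: BT.
by rewrite -[val x]scale1r -sr -scalerA rv; apply: submodZ.
Qed.

(* Steinitz exchange: a maximal partial injection [Z] from [G] to [D] for which
   replacing [N g] by [U d] whenever [Z (g, d)] preserves independence is total. *)
Lemma uniform_dimension_bound (G D : Type) (N : G -> set V) (U : D -> set V) T :
  (forall g, submodule (N g)) -> (forall d, submodule (U d)) ->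
  (forall g, N g `<=` T) -> (forall g, exists n, N g n /\ n <> 0) -> indep N ->
  (forall P n, submodule P -> T n -> n <> 0 ->
    (forall d u, U d u -> u <> 0 -> exists p, [/\ U d p, P p & p <> 0]) ->
    exists r, r *: n <> 0 /\ P (r *: n)) ->
  [set: G] #<= [set: D].
Proof.
move=> hN hU NT N0 indN ess.
pose NZ (Z : set (G * D)) g : set V :=
  [set v | N g v /\ (forall d, ~ Z (g, d)) \/ exists d, Z (g, d) /\ U d v].
pose good Z := [/\ forall g d d', Z (g, d) -> Z (g, d') -> d = d',
  forall g d, Z (g, d) -> exists u, U d u /\ u <> 0 & indep (NZ Z)].
have good0 : good set0.
  split=> // l v [[Nv _]|[d [//]]] Sv; apply: (indN l v Nv).
  by move: Sv; apply: span_bigcupS => // k kl u [[]|[d []]].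
have [F goodF totF|Z [[funZ U0 indZ] maxZ]] := @Zorn_bigcup _ good.
  (* Adjoining the empty relation makes the chain nonempty, and gives indices that are never
     exchanged a link to start from. *)
  pose F' := F `|` [set set0].
  have goodF' X : F' X -> good X by move=> [/goodF|->].
  have upF X Y : F' X -> F' Y -> exists W, [/\ F' W, X `<=` W & Y `<=` W].
    move=> [FX|->] F'Y; last by exists Y; split.
    case: (F'Y) => [FY|->]; last by exists X; split=> [|//|]; [left|apply: sub0set].
    by have [XY|YX] := totF _ _ FX FY; [exists Y|exists X]; split=> //; left.
  have -> : \bigcup_(X in F) X = \bigcup_(X in F') X.
    apply/seteqP; split=> [z [X FX Xz]|z [X [FX|->] Xz] //]; exists X => //.
    by left.
  have memF g d : (\bigcup_(X in F') X) (g, d) -> exists X, F' X /\ X (g, d).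
    by move=> [X FX Xz]; exists X.
  set Zoo := \bigcup_(X in F') X in memF *.
  (* [NZ] is not monotone in the relation, since a member may switch from [N g] to [U d]. Along the
     chain it switches at most once, so membership in the limit holds from some link on. *)
  have stable g v : NZ Zoo g v ->
      exists X, F' X /\ forall Y, F' Y -> X `<=` Y -> NZ Y g v.
    move=> [[Nv Zg]|[d [/memF[X [FX Xz]] Uv]]].
      exists set0; split; first by right.
      by move=> Y FY _; left; split=> // d Yz; apply: (Zg d); exists Y.
    by exists X; split=> // Y FY XY; right; exists d; split=> //; apply: XY.
  split.
  - move=> g d d' /memF[X [FX Xz]] /memF[Y [FY Yz]].
    have [W [FW XW YW]] := upF _ _ FX FY; have [funW _ _] := goodF' _ FW.
    by apply: (funW g); [apply: XW|apply: YW].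
  - by move=> g d /memF[X [FX Xz]]; have [_ /(_ _ _ Xz)] := goodF' _ FX.
  move=> l v /stable[X [FX NX]] Sv.
  (* The elements that lie in the span of the other members from some link on form a submodule.
     Hence a dependence in the limit is already one at a single link. *)
  pose Q := [set u | exists Y, F' Y /\ forall W, F' W -> Y `<=` W ->
    span (\bigcup_(k in [set k | k <> l]) NZ W k) u].
  have : Q v.
    apply: Sv.
      apply/submoduleP; split.
        by exists set0; split=> [|W _ _]; [right|apply: (submod0 (hS _))].
      move=> a x y [Y [FY Yx]] [W [FW Wy]]; have [X' [FX' YX' WX']] := upF _ _ FY FW.
      exists X'; split=> // W' FW' X'W'.
      apply: (submodD (hS _)); first apply: (submodZ (hS _)).
        by apply: Yx => //; apply: subset_trans X'W'.
      by apply: Wy => //; apply: subset_trans X'W'.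
    move=> u [k kl /stable[Y [FY Yu]]]; exists Y; split=> // W FW YW.
    by apply: span_bigcup_mem kl _ _; apply: Yu.
  move=> [Y [FY SY]]; have [W [FW XW YW]] := upF _ _ FX FY.
  by have [_ _ indW] := goodF' _ FW; apply: indW (NX _ FW XW) (SY _ FW YW).
have totZ g : exists d, Z (g, d).
  apply: contrapT => /forallNP Zg; have [n [Nn n0]] := N0 g.
  pose P := span (\bigcup_(k in [set k | k <> g]) NZ Z k).
  (* If [P] met every nonzero [U d], then [ess] would put a nonzero multiple of [n] into [P],
     against independence at [g]. So some nonzero [U d] avoids [P] and can take the place of
     [N g]. *)
  have [d [u [Uu u0 UP]]] : exists d u,
      [/\ U d u, u <> 0 & forall p, U d p -> P p -> p = 0].
    apply: contrapT => no; have [|r [rn0 Prn]] := ess P n (hS _) (NT _ _ Nn) n0.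
      move=> d u Uu u0; apply: contrapT => no'; apply: no; exists d, u; split=> //.
      by move=> p Up Pp; apply: contrapT => p0; apply: no'; exists p.
    apply: rn0; apply: (indZ g) Prn; left; split=> //; exact: submodZ.
  apply: (maxZ (Z `|` [set (g, d)])).
    split; first exact: subsetUl.
    by move=> sub; apply: (Zg d); apply: sub; right.
  have ZgE v : NZ (Z `|` [set (g, d)]) g v <-> U d v.
    split=> [[[_ /(_ d)]|[d' [[/Zg //|[->]] //]]]|Uv].
      by case; right.
    by right; exists d; split=> //; right.
  split.
  - move=> k e e' [Ze|keE] [Ze'|ke'E].
    + exact: funZ Ze Ze'.
    + by move: ke'E Ze => [-> _] /Zg.
    + by move: keE Ze' => [-> _] /Zg.
    + by move: keE ke'E => [_ ->] [_ ->].
  - by move=> k e [/U0 //|[_ ->]]; exists u.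
  apply: (@indep_replace _ (NZ Z) _ g) => //.
  - by rewrite (_ : NZ _ g = U d) //; apply/seteqP; split=> v /ZgE.
  - move=> k kg v [[Nv Zk]|[e [[Ze|[kg' _]] Uv]]] //.
      by left; split=> // e Ze; apply: (Zk e); left.
    by right; exists e.
  - by move=> v /ZgE Uv; apply: UP.
have [f Zf] := choice totZ.
apply: (@card_le_injective _ _ _ _ f) => // g g' _ _ fgg'.
(* Otherwise the same nonzero [U d] would occupy two places of an independent family. *)
apply: contrapT => gg'; have [u [Uu]] := U0 _ _ (Zf g); apply.
apply: (indZ g); first by right; exists (f g).
apply: (@span_bigcup_mem _ _ _ _ _ g') => //; first by move=> /esym.
by right; exists (f g'); rewrite -fgg' in Zf *; split=> //; rewrite fgg'; apply: Zf.
Qed.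

End Independence.

Lemma injective_card_le (A B : Type) :
  [set: A] #<= [set: B] -> exists f : A -> B, injective f.
Proof.
move=> /card_leP[f].
exists (fun x => val (f (exist _ x (mem_set (I : [set: A] x))))) => x y /val_inj fxy.
have := @inj _ _ _ f _ _ (mem_set I) (mem_set I) fxy.
by case.
Qed.

(** * Azumaya's exchange over a local ring *)

Section Exchange.
Variables (R : comPzRingType) (V : lmodType R) (L : choiceType) (w : L -> V).
Implicit Types (v : L -> V) (r : R).
Local Notation span := (@span R V).
Let hS := @span_submodule R V.
Let hC := @submodule_cyclic R V.

Lemma span_cyclic_sum x : span (\bigcup_(l in [set: L]) cyclic (w l)) x ->
  exists (s : seq L) (b : L -> R), uniq s /\ x = \sum_(l <- s) b l *: w l.
Proof.
rewrite span_supported // => -[y [[Cy fy] _] <-].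
have /choice[b yE] : forall l, exists a, a *: w l = y l.
  by move=> l; have [a _ <-] := Cy l; exists a.
exists (finmap.enum_fset (fset_set [set l | y l != 0])), b.
split; first exact: finmap.fset_uniq.
rewrite (@fsum_seq _ _ _ [set l | y l != 0]) //; last first.
  by move=> l /negP/negbNE/eqP.
by apply: eq_bigr => l _; rewrite yE.
Qed.

Lemma indep_sum0 (N : L -> set V) (x : L -> V) (s : seq L) : indep N ->
  uniq s -> {in s, forall l, N l (x l)} -> \sum_(l <- s) x l = 0 ->
  {in s, forall l, x l = 0}.
Proof.
move=> indN us Nx x0 l ls; apply: indN (Nx l ls) _.
have -> : x l = - \sum_(k <- s | k != l) x k.
  by apply/eqP; rewrite -addr_eq0 -bigD1_seq //= x0.
apply: (submodN (hS _)); rewrite -big_filter; apply: (submod_sum (hS _)) => k.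
by rewrite mem_filter => /andP[/eqP kl ks]; apply: span_bigcup_mem (Nx k ks).
Qed.

(* Azumaya's exchange argument: replace the generators [w l] involved in [m *: x]
   one by one by their components in [N'].  This cannot succeed for all of them
   since the component of [m *: x] in [N'] is zero, and at the first failure the
   component of [w l] in [N] generates a direct summand. *)
Lemma local_cyclic_summand (N N' : set V) (m : R) (x : V) :
  (forall r, (exists s, s * r = 1) \/ (exists s, s * (1 - r) = 1)) ->
  direct_sum (fun l => cyclic (w l)) [set: V] ->
  submodule N -> submodule N' -> isum N N' [set: V] -> N x -> m *: x <> 0 ->
  exists n N1, [/\ N n, submodule N1, isum (cyclic n) N1 N & m *: n <> 0].
Proof.
move=> local /direct_sumP[//|spanw indw] hN hN' [_ _ NN' NN'0] Nx mx0.
have /choice[p pP] : forall l, exists u, N u /\ N' (w l - u).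
  move=> l; have [//|u [u' [Nu Nu' ->]]] := NN' (w l).
  by exists u; split=> //; rewrite addrC addKr.
pose q l := w l - p l.
(* A relation on [w l] passes to its two components because [N] and [N'] meet in zero. *)
have annp l r : r *: w l = 0 -> r *: p l = 0.
  move=> rw; have [Np Nq] := pP l; apply: NN'0; first exact: submodZ.
  have -> : r *: p l = - (r *: q l) by rewrite scalerBr rw sub0r opprK.
  by apply: submodN => //; apply: submodZ.
have annq l r : r *: w l = 0 -> r *: q l = 0.
  by move=> rw; rewrite scalerBr rw annp // subr0.
apply: contrapT => fail.
pose v (A : seq L) l := if l \in A then q l else w l.
have exch (A : seq L) : {in A, forall l, m *: w l <> 0} ->
    [/\ [set: V] = span (\bigcup_(l in [set: L]) cyclic (v A l)),
        indep (fun l => cyclic (v A l))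
      & {in A, forall l r, r *: q l = 0 -> r *: w l = 0}].
  elim: A => [|i A IH] Aw; first by split.
  have [|spanv indv annv] := IH; first by move=> l lA; apply: Aw; rewrite inE lA orbT.
  have [iA|/negP iA] := boolP (i \in A).
    have -> : v (i :: A) = v A.
      apply/funext => l; rewrite /v inE; case: eqP => [->|//]; by rewrite iA.
    by split=> // l; rewrite inE => /orP[/eqP->|]; apply: annv.
  have vi : v A i = w i by rewrite /v; case: ifP.
  set T := span (\bigcup_(k in [set k | k <> i]) cyclic (v A k)).
  have hT : submodule T := hS _.
  have [_ _ dec dis] := indep_isum i (fun k => hC (v A k)) indv.
  rewrite -spanv vi -/T in dec dis.
  have [//|_ [t [[a _ <-] Tt pE]]] := dec (p i).
  have Tw r b : T (r *: (b *: w i)) -> r *: (b *: w i) = 0.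
    by move=> Trw; apply: dis => //; rewrite scalerA; apply: cyclicZ.
  (* [a] is the coefficient of [w i] in [p i] with respect to the current family, and [1 - a] the
     one in [q i]. If [a] is a unit, [p i] can replace [w i] and splits off from [N]; if [1 - a] is,
     then [q i] replaces [w i]. *)
  have [[s sa]|[s sa]] := local a.
    case: fail; exists (p i), (N `&` T); have [Np _] := pP i.
    have hNT := submoduleI hN hT.
    split => //.
      split.
      - exact: cyclic_sub.
      - by move=> z [].
      - move=> z Nz; have [//|_ [t' [[b _ <-] Tt' zE]]] := dec z.
        exists ((b * s) *: p i), (z - (b * s) *: p i); split.
        + exact: cyclicZ.
        + split; first by apply: submodB => //; apply: submodZ.
          rewrite zE pE scalerDr scalerA -mulrA sa mulr1 opprD addrACA subrr add0r.
          by apply: (submodB hT) => //; apply: (submodZ hT).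
        + by rewrite addrC subrK.
      - move=> _ [r _ <-] [_]; rewrite pE scalerDr => Tr.
        have : T (r *: (a *: w i)).
          by rewrite -[_ *: _](addrK (r *: t)); apply: (submodB hT) => //; apply: (submodZ hT).
        move=> /Tw ra; rewrite ra add0r.
        have rw : r *: w i = 0.
          by rewrite -[w i]scale1r -sa scalerA mulrCA -scalerA -scalerA ra scaler0.
        by have := annp i r rw; rewrite pE scalerDr ra add0r.
    move=> mp; apply: (Aw i); first by rewrite inE eqxx.
    have : T (m *: (a *: w i)).
      have -> : m *: (a *: w i) = - (m *: t).
        by apply/eqP; rewrite -addr_eq0 -scalerDr -pE mp.
      by apply: (submodN hT); apply: (submodZ hT).
    move=> /Tw ma.
    by rewrite -[w i]scale1r -sa scalerA mulrCA -scalerA -scalerA ma scaler0.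
  have qE : q i = (1 - a) *: w i - t by rewrite /q pE scalerBl scale1r opprD addrA.
  have annqi r : T (r *: q i) -> r *: w i = 0.
    rewrite qE scalerBr => Trq.
    have : T (r *: ((1 - a) *: w i)).
      by rewrite -[_ *: _](subrK (r *: t)); apply: (submodD hT) => //; apply: (submodZ hT).
    move=> /Tw ra.
    by rewrite -[w i]scale1r -sa scalerA mulrCA -scalerA -scalerA ra scaler0.
  have v'i : v (i :: A) i = q i by rewrite /v inE eqxx.
  have v'k k : k <> i -> v (i :: A) k = v A k.
    by move=> /eqP/negPf ki; rewrite /v inE ki.
  split.
  - apply/seteqP; split=> // z _.
    have [//|_ [t' [[b _ <-] Tt' ->]]] := dec z.
    have Tv' u : T u -> span (\bigcup_(l in [set: L]) cyclic (v (i :: A) l)) u.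
      by apply: span_bigcupS => // k ki; rewrite v'k.
    apply: (submodD (hS _)); last exact: Tv'.
    apply: (submodZ (hS _)); have -> : w i = s *: (q i + t).
      by rewrite qE subrK scalerA sa scale1r.
    apply: (submodZ (hS _)); apply: (submodD (hS _)); last exact: Tv'.
    apply: (@span_bigcup_mem _ _ _ _ _ i) => //; rewrite v'i; exact: cyclic_id.
  - apply: (indep_replace (i := i)) indv _ _ => //.
      by move=> k ki; rewrite v'k.
    by rewrite v'i => _ [r _ <-] /annqi/annq.
  - move=> l; rewrite inE => /orP[/eqP-> r rq|]; last exact: annv.
    by apply: annqi; rewrite rq; apply: (submod0 hT).
have [|s [c [us xE]]] := @span_cyclic_sum x; first by rewrite -spanw.
(* A successful split must give [m *: p i <> 0], which needs [m *: w i <> 0]. The indices left out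
   contribute nothing to [m *: x]. *)
pose A := [seq l <- s | m *: w l != 0].
have [|_ indv annv] := exch A; first by move=> l; rewrite mem_filter => /andP[/eqP].
apply: mx0; rewrite xE scaler_sumr big_seq big1 // => l ls.
rewrite scalerA mulrC -scalerA.
have [mw|mw] := eqVneq (m *: w l) 0; first by rewrite mw scaler0.
have lA : l \in A by rewrite mem_filter mw ls.
rewrite scalerA; apply: annv => //.
suff : {in s, forall k, (c k * m) *: q k = 0} by apply.
apply: (indep_sum0 indv) => // [k ks|].
  rewrite /v; case: ifP => [_|/negbT kA]; first exact: cyclicZ.
  have : m *: w k = 0 by apply/eqP; move: kA; rewrite mem_filter ks andbT negbK.
  by move=> /annq mq; rewrite -scalerA mq scaler0; apply: submod0.
(* This sum of elements of [N'] is also [m *: x] minus elements of [N], hence zero. Independence of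
   the exchanged family then kills each term. *)
have NN0 : N (\sum_(l <- s) (c l * m) *: q l).
  have -> : \sum_(l <- s) (c l * m) *: q l
            = m *: x - \sum_(l <- s) (c l * m) *: p l.
    rewrite xE scaler_sumr -sumrB; apply: eq_bigr => k _.
    by rewrite scalerBr scalerA mulrC.
  apply: submodB => //; first exact: submodZ.
  by apply: submod_sum => // k _; have [Np _] := pP k; apply: submodZ.
apply: NN'0 => //; apply: submod_sum => // k _.
by have [_ Nq] := pP k; apply: submodZ.
Qed.

End Exchange.

(** * A submodule as a module in its own right *)

Section SubmoduleType.
Variables (R : pzRingType) (V : lmodType R) (D : set V) (hD : submodule D).

(** The proof of closure is an argument so that the algebraic instances can be attached to the
    predicate. *)
Definition submod_pred of submodule D : {pred V} := [in D].

HB.instance Definition _ :=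
  GRing.isSubmodClosed.Build R V (submod_pred hD) (GRing.submod_closed_semi hD).

Record submod_type := SubmodType {
  submod_val :> V; submod_valP : submod_val \in submod_pred hD }.

HB.instance Definition _ := [isSub for submod_val].
HB.instance Definition _ := [Choice of submod_type by <:].
HB.instance Definition _ := [SubChoice_isSubLmodule of submod_type by <:].

End SubmoduleType.

(** The ambient module is [D] itself, with zero complement; the work lies in carrying spans across
    the inclusion. *)
Lemma direct_sum_cyclic_summand (R : comPzRingType) (V : lmodType R) (D : set V) :
  submodule D -> direct_sum_cyclic D -> summand_of_direct_sum_cyclic D.
Proof.
move=> hD [L [w /direct_sumP[l|DE indw]]]; first exact: submodule_cyclic.
have Dw l : D (w l).
  by rewrite DE; apply: (@span_bigcup_mem _ _ _ _ _ l) => //; apply: cyclic_id.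
pose W : lmodType R := submod_type hD.
have inD v : D v -> v \in submod_pred hD by move=> Dv; apply: mem_set.
pose w' l : W := SubmodType (inD _ (Dw l)).
have hC l := submodule_cyclic (w' l).
exists W, [set: W], [set 0]; split.
- exists L, w'; apply/direct_sumP => //; split.
    apply/seteqP; split=> // u _.
    pose Q := [set v | exists h : v \in submod_pred hD,
      span (\bigcup_(l in [set: L]) cyclic (w' l)) (SubmodType h)].
    have : Q (val u).
      have Du : span (\bigcup_(l in [set: L]) cyclic (w l)) (val u).
        by rewrite -DE; apply: set_mem; apply: submod_valP.
      apply: Du.
        apply/submoduleP; split.
          exists (valP (0 : W)); rewrite (_ : SubmodType _ = 0); last exact: val_inj.
          exact: (submod0 (span_submodule _)).
        move=> a x y [hx Sx] [hy Sy].
        exists (valP (a *: (SubmodType hx : W) + SubmodType hy)).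
        rewrite (_ : SubmodType _ = a *: (SubmodType hx : W) + SubmodType hy).
          apply: (submodD (span_submodule _)) => //.
          exact: (submodZ (span_submodule _)).
        exact: val_inj.
      move=> _ [l _ [a _ <-]]; exists (valP (a *: w' l)).
      apply: (@span_bigcup_mem _ _ _ _ _ l) => //.
      by rewrite (_ : SubmodType _ = a *: w' l); [apply: cyclicZ|apply: val_inj].
    by move=> [h]; rewrite (_ : SubmodType h = u) //; apply: val_inj.
  move=> l _ [a _ <-] Sv; apply: val_inj => /=; apply: (indw l); first exact: cyclicZ.
  pose Q : set W := [set u | span (\bigcup_(k in [set k | k <> l]) cyclic (w k)) (val u)].
  have : Q (a *: w' l).
    apply: Sv.
      apply/submoduleP; split; first exact: (submod0 (span_submodule _)).
      move=> b x y Qx Qy; apply: (submodD (span_submodule _)) => //.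
      exact: (submodZ (span_submodule _)).
    move=> _ [k kl [b _ <-]]; apply: span_bigcup_mem kl _ _; exact: cyclicZ.
  by [].
- exact: submodule_setT.
- exact: submodule_set0.
- apply/direct_sumP => [[]|]; [exact: submodule_setT|exact: submodule_set0|].
  split.
    apply/seteqP; split=> // v _.
    by apply: (@span_bigcup_mem _ _ _ _ _ true).
  move=> [v _|v -> //].
  rewrite (_ : \bigcup_(k in _) _ = [set 0]); last first.
    by apply/seteqP; split=> [u [[]]|u ->] //; exists false.
  by rewrite span_id //; apply: submodule_set0.
(* [insubd] is total, with default value 0 outside [D]; only its values on [D] enter the
   isomorphism. *)
- exists (insubd (0 : W)); split; last first.
    move=> a u v Du Dv; apply: val_inj.
    have uD : u \in submod_pred hD by exact: Du.
    have vD : v \in submod_pred hD by exact: Dv.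
    have uvD : a *: u + v \in submod_pred hD.
      by apply/mem_set; apply: (submodD hD); [apply: (submodZ hD)|]; apply: set_mem.
    by rewrite val_insubd uvD /= !val_insubd uD vD.
  split=> // [u v|u _].
    move=> Du Dv /(congr1 val); rewrite !val_insubd.
    by rewrite (_ : u \in _) // (_ : v \in _).
  exists (val u); first by apply/set_mem; exact: (valP u).
  by apply: val_inj; rewrite val_insubd (valP u).
Qed.

(** * Units, Nakayama's lemma and simple ideals in a local ring *)

Section LocalRing.
Variables (R : comPzRingType) (M : set R^o) (hM : local_ring_with M).
Implicit Types (I J K : set R^o) (a b m r s x y z : R).
Let hS := @span_submodule R R^o.
Let hC (x : R^o) := submodule_cyclic x.

Lemma local_ideal : ideal M. Proof. by case: hM => -[]. Qed.

Lemma local1 : ~ M 1.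
Proof.
move=> M1; case: hM => -[_ /eqP MT _] _; apply: MT; apply/seteqP; split=> // r _.
by have := submodZ local_ideal r M1; rewrite /GRing.scale /= mulr1.
Qed.

(** A nonunit lies in some maximal ideal, which must be [M]. Zorn is applied to sets rather than
    ideals, with [r] adjoined only inside the span, so that the empty chain needs no separate
    treatment. *)
Lemma local_unit r : ~ M r -> exists s, s * r = 1.
Proof.
move=> Mr; apply: contrapT => nr; apply: Mr.
have [F PF totF|A [PA maxA]] :=
    @Zorn_bigcup R^o [set X | ~ span (X `|` [set (r : R^o)]) 1].
  move=> /(span_chain totF)[S1|[X FX]]; last exact: PF.
  have [s _ sr] : cyclic (r : R^o) 1.
    by apply: S1 => // _ ->; apply: cyclic_id.
  by apply: nr; exists s.
set J := span (A `|` [set (r : R^o)]).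
suff maxJ : maximal_ideal J.
  by have [_ /(_ J maxJ) <-] := hM; apply: sub_span; right.
split; first exact: hS.
  by apply/eqP => JT; apply: PA; rewrite -/J JT.
move=> K hK JK; have [KJ|KJ] := pselect (K `<=` J).
  by left; apply/seteqP.
right; have K1 : K 1.
  apply: contrapT => K1; apply: (maxA K).
    split; first by move=> a Aa; apply: JK; apply: sub_span; left.
    by move=> KA; apply: KJ => a /KA Aa; apply: sub_span; left.
  move=> S1; apply: K1; apply: S1 => // a [//|->].
  by apply: JK; apply: sub_span; right.
apply/seteqP; split=> // a _.
by have := submodZ hK a K1; rewrite /GRing.scale /= mulr1.
Qed.

Lemma idealM I a x : ideal I -> I x -> I (a * x).
Proof. by move=> hI Ix; apply: (submodZ hI a Ix). Qed.

Lemma local_subr1 m : M m -> exists s, s * (1 - m) = 1.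
Proof.
move=> Mm; apply: local_unit => Mm'; apply: local1.
by have := submodD local_ideal Mm Mm'; rewrite addrCA subrr addr0.
Qed.

Lemma local_dichotomy r : (exists s, s * r = 1) \/ exists s, s * (1 - r) = 1.
Proof.
by have [Mr|Mr] := pselect (M r); [right; apply: local_subr1|left; apply: local_unit].
Qed.

Lemma proper_ideal_sub I : ideal I -> I != setT -> I `<=` M.
Proof.
move=> hI /eqP IT r Ir; apply: contrapT => /local_unit[s sr]; apply: IT.
apply/seteqP; split=> // a _; rewrite -[a]mulr1 -sr.
exact: (idealM a hI (idealM s hI Ir)).
Qed.

Lemma local_nakayama m x : M m -> x = m * x -> x = 0.
Proof.
move=> /local_subr1[s sm] xm; rewrite -[x]mul1r -sm -mulrA mulrBl mul1r -xm.
by rewrite subrr mulr0.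
Qed.

(** If [m * w] generated all of [cyclic w], then [w = (a * m) * w] for some [a], and Nakayama's
    lemma would give [w = 0]. *)
Lemma simple_cyclic (w : R^o) :
  simple (cyclic w) -> w <> 0 /\ forall m, M m -> m * (w : R) = 0.
Proof.
move=> [_ /eqP w0 simw]; split=> [w0'|m Mm]; first by apply: w0; rewrite w0' cyclic0.
have mw : cyclic (m *: w) `<=` cyclic w by apply: cyclic_sub => //; apply: cyclicZ.
have [mw0|mwE] := simw _ (hC _) mw.
  by have := cyclic_id (m *: w); rewrite mw0.
have [a _ aw] : cyclic (m *: w) w by rewrite mwE; apply: cyclic_id.
have -> : (w : R) = 0; last exact: mulr0.
apply: (@local_nakayama (a * m)); first exact: (idealM a local_ideal Mm).
by rewrite -mulrA; symmetry.
Qed.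

End LocalRing.

(** Azumaya's summand is found in the isomorphic copy [N] of [I] and pulled back along [f], its
    complement becoming a preimage. *)
Lemma cyclic_summand (R : comPzRingType) (I : set R^o) (m x : R) :
  (forall r : R, (exists s, s * r = 1) \/ exists s, s * (1 - r) = 1) ->
  ideal I -> summand_of_direct_sum_cyclic I -> I x -> m * x <> 0 ->
  exists (a : R) J, [/\ I a, ideal J, isum (cyclic (a : R^o)) J I & m * a <> 0].
Proof.
move=> local hI [W [N [N' [[L [w sumw]] hN hN' sumN [f [fbij flin]]]]]] Ix mx0.
have [fN finj fsurj] := fbij.
have isumN : isum N N' [set: W].
  have hB (b : bool) : submodule (if b then N else N') by case: b.
  have := direct_sum_isum true hB sumN.
  rewrite (_ : \bigcup_(k in _) _ = N') ?span_id //.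
  by apply/seteqP; split=> [u [[]]|u] //; exists false.
have I0 : I 0 := submod0 hI.
have fD a u v : I u -> I v -> f (a *: u + v) = a *: f u + f v.
  by move=> Iu Iv; apply: flin; rewrite inE.
have f0 : f 0 = 0.
  have := fD 1 _ _ I0 I0; rewrite scaler0 addr0 scale1r => /eqP.
  by rewrite addrC -subr_eq subrr => /eqP.
have fZ a u : I u -> f (a *: u) = a *: f u.
  by move=> Iu; have := fD a _ _ Iu I0; rewrite f0 !addr0.
have finj' u v : I u -> I v -> f u = f v -> u = v.
  by move=> Iu Iv; apply: finj; rewrite inE.
have mfx : m *: f x <> 0.
  rewrite -fZ // -f0 => /finj' h; apply: mx0; apply: h => //.
  exact: (submodZ hI).
have [n [N1 [Nn hN1 [nN N1N Ndec Ndis] mn]]] :=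
  local_cyclic_summand local sumw hN hN' isumN (fN _ Ix) mfx.
have [a Ia fa] := fsurj _ Nn; have Ira r : I (r *: a) by apply: (submodZ hI).
pose J := [set v | I v /\ N1 (f v)].
have hJ : ideal J.
  apply/submoduleP; split; first by split=> //; rewrite f0; apply: submod0.
  move=> b u v [Iu Nu] [Iv Nv]; split.
    by apply: (submodD hI) => //; apply: (submodZ hI).
  by rewrite fD //; apply: submodD => //; apply: submodZ.
exists a, J; split=> //; last first.
  move=> ma; apply: mn; rewrite -fa -fZ //.
  by have -> : m *: a = 0 by []; rewrite f0.
split.
- by apply: cyclic_sub.
- by move=> v [].
- move=> v Iv; have [_ [t [[r _ <-] Nt fv]]] := Ndec _ (fN _ Iv).
  have [v1 Iv1 fv1] := fsurj _ (N1N _ Nt).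
  exists (r *: a), v1; split; [exact: cyclicZ|by rewrite /J /= fv1|].
  apply: finj' => //; first exact: (submodD hI).
  by rewrite fv fD // fa fv1.
- move=> _ [r _ <-] [_ Nra]; apply: finj' => //; rewrite f0.
  by apply: Ndis => //; rewrite fZ // fa; apply: cyclicZ.
Qed.

Lemma direct_sum_two (S : comPzRingType) (V : lmodType S) (I : set V) (a b : V) :
  submodule I -> isum (cyclic a) (cyclic b) I ->
  direct_sum (fun i : 'I_2 => cyclic (if i == ord0 then a else b)) I.
Proof.
move=> hI; have hC (c : V) := submodule_cyclic c.
move=> /(isumP (hC _) (hC _) hI)[-> dis]; apply/direct_sumP => //; split.
  apply/seteqP; split=> [_ [u au [v bv <-]]|].
    apply: (submodD (span_submodule _)).
      exact: (@span_bigcup_mem _ _ _ _ _ ord0).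
    exact: (@span_bigcup_mem _ _ _ _ _ ord_max).
  apply: span_bigcup_sub; first exact: submodule_msum.
  by move=> i _ v; case: eqP => _ iv; [apply: msuml|apply: msumr].
have sub (l : 'I_2) : span (\bigcup_(k in [set k | k <> l])
    cyclic (if k == ord0 then a else b))
    `<=` cyclic (if l == ord0 then b else a).
  apply: span_bigcup_sub => // k kl v.
  suff -> : (k == ord0) = (l != ord0) by case: (l == ord0).
  case: k l kl {v} => [[|[|//]] k2] [[|[|//]] l2] //= [];
    exact: val_inj.
by move=> l v lv /sub; move: lv; case: eqP => _ ? ?; apply: dis.
Qed.

(** * Ideals of R/Ann(x) read inside R x *)

Section AnnihilatorQuotient.
Variables (R : comPzRingType) (x : R).
Implicit Types (J K : set R^o) (a b r s t : R).

(** R/Ann(x) is isomorphic to R x, so [r * x] stands for the class of [r], and [J] for the preimage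
    of an ideal of the quotient. *)
Definition pir : Prop := forall J, ideal J ->
  exists a, J a /\ forall r, J r -> exists t, r * x = t * (a * x).

Definition two_gen : Prop := forall J, ideal J ->
  exists a b, [/\ J a, J b, forall r, J r -> exists s t,
      r * x = s * (a * x) + t * (b * x)
    & forall s t, s * (a * x) = t * (b * x) -> s * (a * x) = 0].

(** A common consequence of statement (5) and of the condition in form (ii) of (4), strong enough
    for the argument with powers of a generator. *)
Definition cyclic_summands : Prop := forall K, ideal K -> K `<=` cyclic (x : R^o) ->
  forall v, K v -> v <> 0 ->
  exists a K1, [/\ ideal K1, isum (cyclic (a : R^o)) K1 K & a <> 0].

Let Q := quot_Ann x.
Definition quot_pi r : Q := \pi_{ideal_quot (Ann x)} r.
Local Notation pi := quot_pi.

Lemma quot_piM r s : pi r * pi s = pi (r * s).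
Proof. exact: pi_quot_Ann_mul. Qed.

Lemma quot_piD r s : pi r + pi s = pi (r + s).
Proof. exact: pi_quot_Ann_add. Qed.

Lemma quot_pi_eq r s : pi r = pi s <-> r * x = s * x.
Proof.
have := @Quotient.idealrBE _ (Ann x) r s; rewrite inE mulrBl subr_eq0 => rs.
by split=> [rsE|/eqP]; [apply/eqP; rewrite rs; apply/eqP|rewrite rs => /eqP].
Qed.

Lemma quot_pi0 : pi 0 = 0.
Proof. by apply: (addrI (pi 0)); rewrite quot_piD !addr0. Qed.

Lemma quot_pi_eq0 r : pi r = 0 <-> r * x = 0.
Proof. by rewrite -quot_pi0 quot_pi_eq mul0r. Qed.

Lemma quot_pi_surj (q : Q) : exists r, q = pi r.
Proof. by exists (repr (q : {ideal_quot (Ann x)})); rewrite /quot_pi reprK. Qed.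

Lemma quot_pi_preim (I : set Q^o) : ideal I -> ideal [set r : R^o | I (pi r)].
Proof.
move=> hI; apply/submoduleP; split; first by rewrite /= quot_pi0; exact: (submod0 hI).
move=> a u v /= Iu Iv; rewrite -quot_piD -[a *: u]/(a * u) -quot_piM.
by apply: (submodD hI) => //; apply: (submodZ hI).
Qed.

Lemma principal_ideal_ringP : principal_ideal_ring Q <-> pir.
Proof.
split=> [PQ J hJ|px I hI].
  pose I : set Q^o := [set q | exists2 r, J r & q = pi r].
  have hI : ideal I.
    apply/submoduleP; split.
      by exists 0; [exact: (submod0 hJ)|rewrite quot_pi0].
    move=> q _ _ [u Ju ->] [v Jv ->]; have [c ->] := quot_pi_surj q.
    exists (c * u + v); last by rewrite -quot_piD -quot_piM.
    by apply: (submodD hJ) => //; apply: (submodZ hJ).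
  have [q IE] := PQ I hI.
  have [a Ja qa] : I q by rewrite IE; apply: cyclic_id.
  exists a; split=> // r Jr.
  have [q' _ q'E] : cyclic q (pi r) by rewrite -IE; exists r.
  have [t q't] := quot_pi_surj q'; exists t; rewrite mulrA; apply/quot_pi_eq.
  by rewrite -quot_piM -q't -qa.
have [a [Ia aP]] := px _ (quot_pi_preim hI).
exists (pi a); apply/seteqP; split=> [q Iq|]; last exact: cyclic_sub.
have [r qr] := quot_pi_surj q; have [|t rt] := aP r; first by rewrite /= -qr.
by exists (pi t) => //; rewrite qr [LHS]quot_piM; apply/quot_pi_eq; rewrite -mulrA.
Qed.

Lemma two_gen_ideals : two_gen -> ideals_sum_two_principal Q.
Proof.
move=> tx I hI; have [a [b [Ia Ib dec dis]]] := tx _ (quot_pi_preim hI).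
exists 2, (fun i : 'I_2 => if i == ord0 then pi a else pi b); split=> //.
apply: direct_sum_two => //; split; [exact: cyclic_sub|exact: cyclic_sub| |].
  move=> q Iq; have [r qr] := quot_pi_surj q.
  have [|s [t rst]] := dec r; first by rewrite /= -qr.
  exists (pi s * pi a), (pi t * pi b); split; [by exists (pi s)|by exists (pi t)|].
  by rewrite qr !quot_piM quot_piD; apply/quot_pi_eq; rewrite rst mulrDl !mulrA.
move=> _ [q _ <-] [q' _ q'E]; have [s qs] := quot_pi_surj q.
have [t qt] := quot_pi_surj q'.
have scE c d : pi c *: (pi d : Q^o) = pi (c * d) by rewrite -quot_piM.
move: q'E; rewrite qs qt !scE => /quot_pi_eq st.
apply/quot_pi_eq0; rewrite -mulrA; apply: (dis s t).
by rewrite !mulrA st.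
Qed.

(** [K] corresponds to a nonzero ideal of the quotient, so one of its principal summands is nonzero;
    this summand and the span of the others are carried back by multiplication with [x]. *)
Lemma ideals_sum_two_summands : ideals_sum_two_principal Q -> cyclic_summands.
Proof.
move=> twoQ K hK Kx v Kv v0.
pose I : set Q^o := [set q | exists2 r, K (r * x) & q = pi r].
have hI : ideal I.
  apply/submoduleP; split.
    by exists 0; [rewrite mul0r; exact: (submod0 hK)|rewrite quot_pi0].
  move=> q _ _ [r Kr ->] [s Ks ->]; have [c ->] := quot_pi_surj q.
  exists (c * r + s); last by rewrite -quot_piD -quot_piM.
  rewrite mulrDl -mulrA; apply: (submodD hK) => //; exact: (submodZ hK).
have KI r : I (pi r) -> K (r * x) by move=> [s Ks /quot_pi_eq ->].
have [n [c [_ sumI]]] := twoQ I hI.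
have hC i := submodule_cyclic (c i).
have [i ci0] : exists i, c i <> 0.
  apply: contrapT => /forallNP c0; apply: v0; have [r _ rv] := Kx _ Kv.
  have Ir : I (pi r) by exists r => //; have -> : r * x = v by [].
  rewrite -rv; apply/quot_pi_eq0.
  have [IE _] := (direct_sumP _ hC).1 sumI; rewrite IE in Ir.
  apply: (@span_sub _ _ _ [set 0] _ _ _ Ir); first exact: submodule_set0.
  move=> q [j _]; have /contrapT -> := c0 j; by rewrite cyclic0.
have [aI SI dec dis] := direct_sum_isum i hC sumI.
move: dec dis SI; set S := span _ => dec dis SI; have hS : submodule S := span_submodule _.
have [a ca] := quot_pi_surj (c i).
exists (a * x), [set w : R^o | exists2 r, S (pi r) & w = r * x].
have hK1 : ideal [set w : R^o | exists2 r, S (pi r) & w = r * x].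
  apply/submoduleP; split; first by exists 0; [rewrite quot_pi0; exact: (submod0 hS)|rewrite mul0r].
  move=> b _ _ [r Sr ->] [s Ss ->]; exists (b * r + s).
    by rewrite -quot_piD -quot_piM; apply: (submodD hS) => //; apply: (submodZ hS).
  by rewrite mulrDl -mulrA.
split=> //; last by move=> /quot_pi_eq0; rewrite -ca.
split.
- apply: cyclic_sub => //; apply: KI; rewrite -ca; apply: aI; exact: cyclic_id.
- by move=> _ [r Sr ->]; apply: KI; apply: SI.
- move=> w Kw; have [r _ rw] := Kx _ Kw.
  have Ir : I (pi r) by exists r => //; have -> : r * x = w by [].
  have [_ [u [[q _ <-] Su rE]]] := dec _ Ir.
  have [t qt] := quot_pi_surj q; have [s us] := quot_pi_surj u.
  exists (t * (a * x)), (s * x); split; first exact: (cyclicZ t (a * x : R^o)).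
    by exists s; rewrite -?us.
  rewrite -rw mulrA -mulrDl; apply/quot_pi_eq.
  by rewrite rE us -quot_piD -quot_piM -qt -ca.
- move=> _ [t _ <-] [s Ss tsE].
  have ts : pi (t * a) = pi s by apply/quot_pi_eq; rewrite -tsE -mulrA.
  rewrite tsE; apply/quot_pi_eq0; apply: dis => //.
  by rewrite -ts -quot_piM -ca; apply: cyclicZ.
Qed.

End AnnihilatorQuotient.

(** * The principal ideal condition over a local ring *)

Section PrincipalIdealRings.
Variables (R : comPzRingType) (M : set R^o) (hM : local_ring_with M).
Implicit Types (I J K S : set R^o) (a b c m r s x y z : R).

Lemma pir0 : pir (0 : R).
Proof.
move=> J hJ; exists 0; split=> [|r _]; first exact: (submod0 hJ).
by exists 0; rewrite !mulr0.
Qed.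

(** The ideal [J c] has a generator [a * c] modulo Ann(x), and [a] then serves for [J] modulo Ann(c
    x). *)
Lemma pirM c x : pir x -> pir (c * x).
Proof.
move=> px J hJ; pose J' : set R^o := [set u | exists2 r, J r & u = r * c].
have hJ' : ideal J'.
  apply/submoduleP; split; first by exists 0; [exact: (submod0 hJ)|rewrite mul0r].
  move=> a _ _ [r Jr ->] [s Js ->]; exists (a * r + s).
    by apply: (submodD hJ) => //; apply: (submodZ hJ).
  by rewrite mulrDl -mulrA.
have [_ [[a Ja ->] aP]] := px J' hJ'; exists a; split=> // r Jr.
have [|t rt] := aP (r * c); first by exists r.
by exists t; rewrite !mulrA in rt *.
Qed.

Lemma pir_ann x y : (forall r, r * x = 0 <-> r * y = 0) -> pir x -> pir y.
Proof.
move=> xy px J hJ; have [a [Ja aP]] := px J hJ; exists a; split=> // r Jr.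
have [t rt] := aP r Jr; exists t; apply/eqP; rewrite -subr_eq0 mulrA -mulrBl.
by apply/eqP/xy; rewrite mulrBl rt mulrA subrr.
Qed.

Lemma pir_uniform x (p q : R) : pir x ->
  cyclic (x : R^o) p -> cyclic (x : R^o) q -> p <> 0 -> q <> 0 ->
  exists a b, a * p = b * q /\ a * p <> 0.
Proof.
move=> px [p0 _ pE] [q0 _ qE] pn0 qn0.
pose J : set R^o := [set r | exists a b, r * x = a * p + b * q].
have hJ : ideal J.
  apply/submoduleP; split; first by exists 0, 0; rewrite !mul0r addr0.
  move=> r u v [a [b uE]] [a' [b' vE]]; exists (r * a + a'), (r * b + b').
  by rewrite mulrDl -[r *: u * x]mulrA uE vE; ring.
have [c [[g [d cE]] cP]] := px J hJ.
have [|a pa] := cP p0.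
  by exists 1, 0; rewrite mul1r mul0r addr0.
have [|b qb] := cP q0.
  by exists 0, 1; rewrite mul1r mul0r add0r.
have {}pE : p = a * (c * x) by rewrite -pa.
have {}qE : q = b * (c * x) by rewrite -qb.
have cx0 : c * x <> 0 by move=> cx; apply: pn0; rewrite pE cx mulr0.
have [ga|ga] := pselect (M a); last first.
  have [s sa] := local_unit hM ga; exists (b * s), 1.
  have -> : b * s * p = b * (s * a) * (c * x) by rewrite pE; ring.
  by rewrite sa mulr1 -qE mul1r.
have [gb|gb] := pselect (M b); last first.
  have [s sb] := local_unit hM gb; exists 1, (a * s).
  have -> : a * s * q = a * (s * b) * (c * x) by rewrite qE; ring.
  by rewrite sb mulr1 -pE mul1r.
case: cx0; apply: (local_nakayama (m := g * a + d * b) hM).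
  by apply: (submodD (local_ideal hM)); apply: (submodZ (local_ideal hM)).
by rewrite {1}cE pE qE; ring.
Qed.

(* The intersection of the [R z^(k+1)] is stable under division by [z]; a cyclic
   direct summand [R a] of it would satisfy [R a = z R a], hence vanish. *)
Lemma pir_cyclic_summands z : M z ->
  (forall m, M m -> exists a, m * z = a * (z * z)) ->
  cyclic_summands z -> pir z.
Proof.
move=> Mz Mzz cs.
(* Take the last power of [z] dividing [v]. The cofactor is a unit, since a cofactor in [M] would
   yield one more factor [z] by [Mzz]. Exponents are shifted by one so that the filtration starts at
   [R z]. *)
have power v : cyclic (z : R^o) v -> (exists k, forall c, v <> c * z ^+ k.+1) ->
    exists k c s, s * c = 1 /\ v = c * z ^+ k.+1.
  move=> [c0 _ vc0] exk.
  have [|k /asboolP vk kmin] :=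
      @ex_minnP (fun k => `[< forall c, v <> c * z ^+ k.+1 >]).
    by have [k vk] := exk; exists k; apply/asboolP.
  case: k vk kmin => [|k] vk kmin; first by case: (vk c0); rewrite expr1 -vc0.
  have [c vc] : exists c, v = c * z ^+ k.+1.
    apply: contrapT => /forallNP no.
    by have := kmin k; rewrite ltnn => /(_ (asboolT no)).
  have [Mc|Mc] := pselect (M c); last first.
    by have [s sc] := local_unit hM Mc; exists k, c, s.
  have [a ca] := Mzz c Mc; case: (vk a).
  by rewrite vc exprS mulrA ca !exprS; ring.
pose Z : set R^o := [set v | forall k, exists c, v = c * z ^+ k.+1].
have hZ : ideal Z.
  apply/submoduleP; split; first by move=> k; exists 0; rewrite mul0r.
  move=> a u v Zu Zv k; have [c ->] := Zu k; have [d ->] := Zv k.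
  by exists (a * c + d); rewrite mulrDl -mulrA.
have Zz : Z `<=` cyclic (z : R^o).
  by move=> v /(_ 0)[c ->]; rewrite expr1; apply: (cyclicZ c (z : R^o)).
have Z0 v : Z v -> v = 0.
  move=> Zv; apply: contrapT => v0.
  have [a [K1 [hK1 [aZ _ dec dis] a0]]] := cs Z hZ Zz v Zv v0.
  have Za : Z a by apply: aZ; apply: cyclic_id.
  (* Write [a = c * z ^+ 2]. If [c * z] were outside [Z], then [a] would be a unit times some
     [z ^+ k.+2]; as [a] is also a multiple of [z ^+ k.+3], Nakayama's lemma gives [z ^+ k.+2 = 0],
     hence [a = 0]. *)
  have [j Zj aj] : exists2 j : R, Z j & a = z * j.
    have [c ac] := Za 1; exists (c * z); last by rewrite ac expr2; ring.
    apply: contrapT => nZ.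
    have [||k [d [s [sd czE]]]] := power (c * z); first exact: (cyclicZ c (z : R^o)).
      apply: contrapT => /forallNP no; apply: nZ => k.
      by apply: contrapT => /forallNP /(no k).
    have aE : a = d * z ^+ k.+2.
      by rewrite [z ^+ k.+2]exprSr mulrA -czE ac expr2 mulrA.
    have [e ae] := Za k.+2.
    have zk0 : z ^+ k.+2 = 0.
      apply: (@local_nakayama _ _ hM (s * e * z)).
        exact: (idealM _ (local_ideal hM)).
      by rewrite -{1}[z ^+ k.+2]mul1r -sd -mulrA -aE ae exprS; ring.
    by apply: a0; rewrite aE zk0 mulr0.
  have [_ [k1 [[r _ <-] Kk1 jE]]] := dec j Zj.
  apply: a0; apply: (@local_nakayama _ _ hM (z * r)).
    by rewrite mulrC; apply: (idealM _ (local_ideal hM)).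
  apply/eqP; rewrite -subr_eq0 -{1}[a]mul1r -mulrBl; apply/eqP; apply: dis.
    exact: (cyclicZ (1 - z * r) (a : R^o)).
  have -> : (1 - z * r) * a = z * k1.
    have {}jE : j = r * a + (k1 : R) := jE.
    by rewrite mulrBl mul1r {1}aj jE; ring.
  exact: (idealM _ hK1).
(* [P] singles out the powers of [z] lying in [J z]. Every nonzero element of [J z] is a unit times
   such a power, so the least exponent gives a generator. *)
move=> J hJ; pose P k := `[< exists r s, J r /\ z ^+ k.+1 = s * (r * z) >].
have JP r : J r -> r * z = 0 \/ exists k c, P k /\ r * z = c * z ^+ k.+1.
  move=> Jr; have [Zr|nZr] := pselect (Z (r * z)); first by left; apply: Z0.
  right; have [||k [c [s [sc rzE]]]] := power (r * z).
  - exact: (cyclicZ r (z : R^o)).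
  - apply: contrapT => /forallNP no; apply: nZr => k.
    by apply: contrapT => /forallNP /(no k).
  exists k, c; split=> //; apply/asboolP; exists r, s.
  by rewrite rzE mulrA sc mul1r.
have [exk|nok] := pselect (exists k, P k); last first.
  exists 0; split=> [|r Jr]; first exact: (submod0 hJ).
  exists 0; rewrite mul0r; have [//|[k [c [Pk _]]]] := JP r Jr.
  by case: nok; exists k.
have [k /asboolP[a [s [Ja zE]]] kmin] := ex_minnP exk.
exists a; split=> // r Jr; have [->|[i [c [Pi ->]]]] := JP r Jr.
  by exists 0; rewrite mul0r.
exists (c * z ^+ (i - k) * s).
rewrite -[RHS]mulrA -zE -mulrA -exprD addnS subnK //; exact: kmin.
Qed.

End PrincipalIdealRings.

(** * Decompositions into two cyclic ideals and a remainder *)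

Section Triples.
Variable R : comPzRingType.
Implicit Types (I J K S T : set R^o) (a b c m r s x y z : R).

(** The internal direct sum of [R x], [R y] and [S] with explicit coefficients, a form suited to
    ring computations; [S] remains an ideal until a basis is chosen. *)
Definition tri x y S I : Prop :=
  [/\ I x, I y, S `<=` I,
    forall v, I v -> exists a b s, S s /\ v = a * x + b * y + s
    & forall a b s, S s -> a * x + b * y + s = 0 ->
        [/\ a * x = 0, b * y = 0 & s = 0]].

Lemma triP x y S I : ideal S -> ideal I ->
  tri x y S I <->
  exists T, [/\ ideal T, isum (cyclic (y : R^o)) S T & isum (cyclic (x : R^o)) T I].
Proof.
move=> hS hI; have hC c := submodule_cyclic (c : R^o).
split=> [[Ix Iy SI dec dis]|[T [hT [yT ST decT disT] [xI TI decI disI]]]].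
  exists (msum (cyclic (y : R^o)) S); have hT := submodule_msum (hC y) hS.
  split=> //.
    apply/isumP => //; split=> // _ [b _ <-] Sb.
    have [] := dis 0 (- b) (b * y) Sb; first by ring.
    by [].
  split.
  - exact: cyclic_sub.
  - move=> _ [_ [b _ <-] [s Ss <-]]; apply: (submodD hI); last exact: SI.
    exact: (submodZ hI b Iy).
  - move=> v Iv; have [a [b [s [Ss ->]]]] := dec v Iv.
    exists (a * x), (b * y + s); split; last by rewrite addrA.
      exact: (cyclicZ a (x : R^o)).
    by exists (b * y); [exact: (cyclicZ b (y : R^o))|exists s].
  - move=> _ [a _ <-] [_ [b _ <-] [s Ss bs]].
    have bs' : b * y + s = a * x := bs.
    have [] := dis (- a) b s Ss; first by rewrite -addrA bs' mulNr addNr.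
    by rewrite mulNr => /eqP; rewrite oppr_eq0 => /eqP.
split.
- by apply: xI; apply: cyclic_id.
- by apply: TI; apply: yT; apply: cyclic_id.
- by move=> s /ST/TI.
- move=> v /decI[_ [_ [[a _ <-] /decT[_ [s [[b _ <-] Ss ->]]] ->]]].
  by exists a, b, s; split=> //; rewrite -[LHS]/(a * x + (b * y + s)) addrA.
- move=> a b s Ss abs.
  have Tbs : T (b * y + s).
    by apply: (submodD hT); [apply: yT; apply: (cyclicZ b (y : R^o))|apply: ST].
  have ax0 : a * x = 0.
    apply: disI; first exact: (cyclicZ a (x : R^o)).
    have -> : a * x = - (b * y + s) by apply/eqP; rewrite -addr_eq0 addrA abs.
    exact: (submodN hT).
  have by0 : b * y = 0.
    apply: disT; first exact: (cyclicZ b (y : R^o)).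
    have -> : b * y = - s by apply/eqP; rewrite -addr_eq0 -abs ax0 add0r.
    exact: (submodN hS).
  by split=> //; rewrite -abs ax0 by0 !add0r.
Qed.

Lemma sum_two_tri (L : choiceType) I x y (w : L -> R^o) : ideal I ->
  direct_sum (fun i => cyclic (oapp (oapp w y) x i)) I <->
  exists S, [/\ ideal S, direct_sum (fun l => cyclic (w l)) S & tri x y S I].
Proof.
move=> hI.
have hC1 (i : option (option L)) := submodule_cyclic (oapp (oapp w y) x i).
have hC2 (i : option L) := submodule_cyclic (oapp w y i).
have hC3 (l : L) := submodule_cyclic (w l).
split.
  move=> /(direct_sum_option hC1 hI)[T [sumT xTI]].
  have hT := direct_sum_submodule hC2 sumT.
  have [S [sumS ySI]] := (direct_sum_option hC2 hT).1 sumT.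
  have hS := direct_sum_submodule hC3 sumS.
  by exists S; split=> //; apply/triP => //; exists T.
move=> [S [hS sumS /(triP _ _ hS hI)[T [hT yST xTI]]]].
apply/(direct_sum_option hC1 hI); exists T; split=> //.
by apply/(direct_sum_option hC2 hT); exists S.
Qed.

Lemma isum_tri0 x S I : ideal I -> ideal S ->
  isum (cyclic (x : R^o)) S I -> tri x 0 S I.
Proof.
move=> hI hS xSI; apply/triP => //; exists S; split=> //.
rewrite cyclic0; split=> //; first by move=> _ ->; exact: (submod0 hS).
by move=> s Ss; exists 0, s; rewrite add0r.
Qed.

Lemma isum_disjoint_mul A B I a b : ideal A -> ideal B -> isum A B I ->
  A a -> B b -> a * b = 0.
Proof.
move=> hA hB [_ _ _ dis] Aa Bb; apply: dis; last exact: (idealM a hB Bb).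
by rewrite mulrC; apply: (idealM b hA Aa).
Qed.

Lemma tri_mul x y S I : ideal S -> ideal I -> tri x y S I ->
  [/\ x * y = 0, forall s, S s -> x * s = 0 & forall s, S s -> y * s = 0].
Proof.
move=> hS hI [Ix Iy SI dec dis]; split.
- have [] := dis y (- x) 0 (submod0 hS); first by ring.
  by rewrite mulrC.
- move=> s Ss; have [] := dis (- s) 0 (x * s) (idealM x hS Ss); first by ring.
  by [].
- move=> s Ss; have [] := dis 0 (- s) (y * s) (idealM y hS Ss); first by ring.
  by [].
Qed.

End Triples.

(** * Proper ideals under the decomposition of the maximal ideal *)

Section Classification.
Variables (R : comPzRingType) (M : set R^o) (hM : local_ring_with M).
Variables (x y : R) (S : set R^o).
Hypotheses (hS : ideal S) (triM : tri x y S M).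
Hypothesis MS : forall m s, M m -> S s -> m * s = 0.
Hypotheses (px : pir x) (py : pir y).
Implicit Types (I J K : set R^o).
Let hMi := local_ideal hM.

Lemma annihilator_max (c r : R) : c <> 0 -> r * c = 0 -> M r.
Proof.
move=> c0 rc; apply: contrapT => /(local_unit hM)[s sr]; apply: c0.
by rewrite -[c]mul1r -sr -mulrA rc mulr0.
Qed.

(* [g] and [h] generate the projections of [I] to [R x] and [R y]; the two cases
   are whether or not [I] contains elements of the form [g + s] and [h + t]. *)
Lemma ideal_classification I : ideal I -> I `<=` M ->
  exists n m : R, tri n m (I `&` S) I /\ (pir n /\ pir m \/ m = 0).
Proof.
move=> hI IM; have [Mx My SM dec dis] := triM.
have [xy0 xS yS] := tri_mul hS hMi triM.
have hIS : ideal (I `&` S) by apply: submoduleI.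
pose Jx : set R^o := [set a : R^o | exists (b s : R), S s /\ I (a * x + b * y + s)].
pose Jy : set R^o := [set b : R^o | exists (a s : R), S s /\ I (a * x + b * y + s)].
have hJx : ideal Jx.
  apply/submoduleP; split.
    by exists 0, 0; rewrite !mul0r !addr0; split; [apply: (submod0 hS)|apply: (submod0 hI)].
  move=> r a a' [b [s [Ss Ia]]] [b' [s' [Ss' Ia']]]; exists (r * b + b'), (r * s + s').
  split; first by apply: (submodD hS) => //; apply: (idealM r hS).
  rewrite [X in I X](_ : _ = r * (a * x + b * y + s) + (a' * x + b' * y + s')).
    by apply: (submodD hI) => //; apply: (idealM r hI).
  by rewrite -[r *: a]/(r * (a : R)); ring.
have hJy : ideal Jy.
  apply/submoduleP; split.
    by exists 0, 0; rewrite !mul0r !addr0; split; [apply: (submod0 hS)|apply: (submod0 hI)].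
  move=> r b b' [a [s [Ss Ia]]] [a' [s' [Ss' Ia']]]; exists (r * a + a'), (r * s + s').
  split; first by apply: (submodD hS) => //; apply: (idealM r hS).
  rewrite [X in I X](_ : _ = r * (a * x + b * y + s) + (a' * x + b' * y + s')).
    by apply: (submodD hI) => //; apply: (idealM r hI).
  by rewrite -[r *: b]/(r * (b : R)); ring.
have [a0 [[b1 [s1 [Ss1 In]]] a0P]] := px hJx.
have [b0 [[a1 [t1 [St1 Im]]] b0P]] := py hJy.
set g := a0 * x in In a0P; set h := b0 * y in Im b0P.
have decI e : I e -> exists xi eta s, S s /\ e = xi * g + eta * h + s.
  move=> Ie; have [a [b [s [Ss eE]]]] := dec e (IM _ Ie).
  have [|xi axi] := a0P a; first by exists b, s; rewrite -eE.
  have [|eta beta] := b0P b; first by exists a, s; rewrite -eE.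
  by exists xi, eta, s; rewrite -axi -beta.
have disI xi eta s : S s -> xi * g + eta * h + s = 0 ->
    [/\ xi * g = 0, eta * h = 0 & s = 0].
  by move=> Ss; rewrite /g /h !mulrA; apply: dis.
(* The annihilator of a nonzero [c] lies in [M], which kills [S]. Thus [c + s] has the same
   annihilator as [c], and adding a socle term preserves [pir]. *)
have kill c xi s : (c = 0 -> s = 0) -> S s -> xi * c = 0 -> xi * s = 0.
  move=> cs Ss xic; have [c0|c0] := pselect (c = 0); first by rewrite cs // mulr0.
  by apply: MS => //; apply: annihilator_max xic.
have pir_shift c s : pir c -> (c = 0 -> s = 0) -> S s ->
    (forall r, r * (c + s) = 0 -> r * c = 0) -> pir (c + s).
  move=> pc cs Ss rcs; apply: pir_ann pc => r; split; last exact: rcs.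
  by move=> rc; rewrite mulrDr rc (kill c) // addr0.
(* When [g = 0] the element [g + s] would already lie in the intersection of [I] and [S], so [s]
   must vanish as well; likewise for [h] and [t]. *)
have split_case s t : S s -> S t -> I (g + s) -> I (h + t) ->
    (g = 0 -> s = 0) -> (h = 0 -> t = 0) ->
    exists n m : R, tri n m (I `&` S) I /\ (pir n /\ pir m \/ m = 0).
  move=> Ss St Ig Ih gs ht; exists (g + s), (h + t); split; last first.
    left; split.
      apply: pir_shift => //; first exact: pirM.
      move=> r; rewrite mulrDr => rg.
      by have [] := disI r 0 (r * s) (idealM r hS Ss); rewrite ?mul0r ?addr0.
    apply: pir_shift => //; first exact: pirM.
    move=> r; rewrite mulrDr => rh.
    by have [] := disI 0 r (r * t) (idealM r hS St); rewrite ?mul0r ?add0r.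
  split=> // [v Iv|xi eta u [_ Su] e0].
    have [xi [eta [u [Su vE]]]] := decI v Iv.
    exists xi, eta, (v - (xi * (g + s) + eta * (h + t))); split; last by ring.
    split.
      apply: (submodB hI) => //.
      by apply: (submodD hI); [apply: (idealM xi hI)|apply: (idealM eta hI)].
    rewrite [X in S X](_ : _ = u - (xi * s + eta * t)); last by rewrite vE; ring.
    apply: (submodB hS) => //.
    by apply: (submodD hS); [apply: (idealM xi hS)|apply: (idealM eta hS)].
  have [||xig etah] := disI xi eta (xi * s + eta * t + u).
  - apply: (submodD hS) => //.
    by apply: (submodD hS); [apply: (idealM xi hS)|apply: (idealM eta hS)].
  - by rewrite -e0; ring.
  rewrite (kill g) // (kill h) // !add0r => u0.
  by rewrite !mulrDr xig etah (kill g) // (kill h) // !addr0.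
have [beta b1E] : exists beta, b1 * y = beta * h by apply: b0P; exists a0, s1.
have [alpha a1E] : exists alpha, a1 * x = alpha * g by apply: a0P; exists b0, t1.
rewrite b1E in In; rewrite a1E in Im.
have I0 : I 0 := submod0 hI; have S0 : S 0 := submod0 hS.
have [g0|g0] := pselect (g = 0).
  have [h0|h0] := pselect (h = 0).
    by apply: (split_case 0 0) => //; rewrite ?g0 ?h0 addr0.
  apply: (split_case 0 t1) => //; first by rewrite g0 addr0.
  by move: Im; rewrite g0 mulr0 add0r.
have [h0|h0] := pselect (h = 0).
  apply: (split_case s1 0) => //; last by rewrite h0 addr0.
  by move: In; rewrite h0 mulr0 addr0.
(* Subtracting [xi] times [g + beta * h + s1] from such an element leaves [eta - beta * xi] times
   [h], plus a socle term. If that coefficient is a unit, [I] contains some [h + t], and then some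
   [g + s]. *)
have [[xi [eta [s [Ss [Ie Mu]]]]]|nou] := pselect (exists xi eta s,
    S s /\ (I (xi * g + eta * h + s) /\ ~ M (eta - beta * xi))).
  have [u ue] := local_unit hM Mu.
  pose t := u * (s - xi * s1); have St : S t.
    apply: (idealM u hS); apply: (submodB hS) => //; exact: (idealM xi hS).
  have It : I (h + t).
    have -> : h + t = u * ((xi * g + eta * h + s) - xi * (g + beta * h + s1)).
      by rewrite -[h in LHS]mul1r -ue /t; ring.
    by apply: (idealM u hI); apply: (submodB hI) => //; apply: (idealM xi hI).
  apply: (split_case (s1 - beta * t) t) => //.
    by apply: (submodB hS) => //; apply: (idealM beta hS).
  have -> : g + (s1 - beta * t) = (g + beta * h + s1) - beta * (h + t) by ring.
  by apply: (submodB hI) => //; apply: (idealM beta hI).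
have {}nou xi eta s : S s -> I (xi * g + eta * h + s) -> M (eta - beta * xi).
  by move=> Ss Ie; apply: contrapT => Mu; apply: nou; exists xi, eta, s.
(* Applied to the element with y-component [h], [nou] puts [1 - beta * alpha] in [M], so [beta] must
   be a unit. *)
have Mb : ~ M beta.
  move=> Mb; apply: (local1 hM).
  have := nou alpha 1 t1 St1; rewrite mul1r => /(_ Im) M1.
  have -> : 1 = (1 - beta * alpha) + alpha * beta by ring.
  by apply: (submodD hMi) => //; apply: (idealM alpha hMi).
have [beta' bb'] := local_unit hM Mb.
exists (g + beta * h + s1), 0; split; last by right.
set n := g + beta * h + s1 in In *.
have yn : y * n = y * (beta * h).
  have -> : y * n = a0 * (x * y) + y * (beta * h) + y * s1 by rewrite /n /g; ring.
  by rewrite xy0 (yS s1 Ss1) mulr0 add0r addr0.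
split=> // [e Ie|xi b u [_ Su]].
  have [xi [eta [s [Ss eE]]]] := decI e Ie.
  have := nou xi eta s Ss; rewrite -eE => /(_ Ie) Mr.
  have [c [b [t [St rE]]]] := dec _ Mr.
  (* The coefficient lies in [M], and only its y-part [b * y] acts on [h]. Since
     [y * n = beta * (y * h)] with [beta] a unit, this action is a multiple of [n]; hence [n] alone
     generates [I] up to [S]. *)
  have rh : (eta - beta * xi) * h = (b * beta' * y) * n.
    have -> : b * beta' * y * n = b * beta' * (y * n) by ring.
    have -> : (eta - beta * xi) * h = b0 * (c * (x * y) + b * y * y + y * t).
      by rewrite rE /h; ring.
    rewrite yn xy0 (yS t St) /h mulr0 add0r addr0.
    have -> : b * beta' * (y * (beta * (b0 * y))) = (beta' * beta) * (b * y * (b0 * y)).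
      by ring.
    by rewrite bb'; ring.
  pose d := xi + b * beta' * y.
  exists d, 0, (s - xi * s1); split; last first.
    have -> : d * n = xi * n + (eta - beta * xi) * h by rewrite rh /d; ring.
    by rewrite eE /n; ring.
  split; last by apply: (submodB hS) => //; apply: (idealM xi hS).
  have -> : s - xi * s1 = e - d * n.
    have -> : d * n = xi * n + (eta - beta * xi) * h by rewrite rh /d; ring.
    by rewrite eE /n; ring.
  by apply: (submodB hI) => //; apply: (idealM d hI).
rewrite mulr0 addr0 => e0.
have [||xig xih] := disI xi (xi * beta) (xi * s1 + u).
- by apply: (submodD hS) => //; apply: (idealM xi hS).
- by rewrite -e0 /n; ring.
have xis : xi * s1 = 0 by apply: MS => //; apply: annihilator_max xig.
rewrite xis add0r => u0; split=> //.
by rewrite /n !mulrDr xig mulrA xih xis !addr0.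
Qed.

(** For [J] inside [M], the ideal [J n] meets [S] in zero, since [J] kills the [S]-part of [n]. Its
    classification therefore has no simple part, only two cyclic summands. *)
Lemma two_gen_max (n : R) : M n -> two_gen n.
Proof.
move=> Mn J hJ; have [[r0 [Jr0 /(local_unit hM)[u ur]]]|JM] :=
    pselect (exists r, J r /\ ~ M r).
  exists r0, 0; split=> // [|r _|s t]; first exact: (submod0 hJ).
    by exists (r * u), 0; rewrite !mul0r addr0 mulrA -[r * u * r0]mulrA ur mulr1.
  by rewrite mul0r mulr0.
have {}JM r : J r -> M r by move=> Jr; apply: contrapT => Mr; apply: JM; exists r.
pose K : set R^o := [set v | exists2 r, J r & v = r * n].
have hK : ideal K.
  apply/submoduleP; split; first by exists 0; [exact: (submod0 hJ)|rewrite mul0r].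
  move=> a _ _ [r Jr ->] [s Js ->]; exists (a * r + s).
    by apply: (submodD hJ) => //; apply: (idealM a hJ).
  by rewrite mulrDl -mulrA.
have [Mx My SM dec dis] := triM.
have KM : K `<=` M by move=> _ [r _ ->]; apply: (idealM r hMi).
have KS v : K v -> S v -> v = 0.
  move=> [r Jr ->] Srn; have [a [b [s [Ss nE]]]] := dec n Mn.
  have [] := dis (- (r * a)) (- (r * b)) (r * n) Srn => //.
  rewrite nE !mulrDr (MS (JM _ Jr) Ss).
  by ring.
have [n1 [m1 [[[a Ja ->] [b Jb ->] _ decK disK] _]]] := ideal_classification hK KM.
exists a, b; split=> // [r Jr|s t st].
  have [|s [t [u [[Ku Su] rE]]]] := decK (r * n); first by exists r.
  by exists s, t; rewrite rE (KS u) // addr0.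
have [] := disK s (- t) 0 => //.
  by split; [exact: (submod0 hK)|exact: (submod0 hS)].
by rewrite st mulNr subrr addr0.
Qed.

(** If [x * n] or [y * n] is nonzero, it lies in the uniform module [R x] or [R y], where [P] is
    met. If both vanish, the components of [n] in [R x] and [R y] are killed by [M], and such
    elements already belong to [P]. *)
Lemma max_essential P (n : R) : ideal P -> M n -> n <> 0 ->
  (forall c : R, c <> 0 -> cyclic (x : R^o) c ->
     exists p : R, [/\ cyclic (x : R^o) p, P p & p <> 0]) ->
  (forall c : R, c <> 0 -> cyclic (y : R^o) c ->
     exists p : R, [/\ cyclic (y : R^o) p, P p & p <> 0]) ->
  S `<=` P -> exists r : R, r * n <> 0 /\ P (r * n).
Proof.
move=> hP Mn n0 Px Py SP; have [Mx My SM dec dis] := triM.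
have [xy0 xS yS] := tri_mul hS hMi triM.
have meet z c : pir z ->
    (forall c : R, c <> 0 -> cyclic (z : R^o) c ->
       exists p : R, [/\ cyclic (z : R^o) p, P p & p <> 0]) ->
    cyclic (z : R^o) c -> c <> 0 -> exists r, r * c <> 0 /\ P (r * c).
  move=> pz Pz zc c0; have [p [zp Pp p0]] := Pz c c0 zc.
  have [a [b [ab ac0]]] := pir_uniform hM pz zc zp c0 p0.
  by exists a; split=> //; rewrite ab; apply: (idealM b hP).
have [a [b [s [Ss nE]]]] := dec n Mn.
have xn : x * n = (a * x) * x.
  have -> : x * n = a * x * x + b * (x * y) + x * s by rewrite nE; ring.
  by rewrite xy0 (xS s Ss) mulr0 !addr0.
have yn : y * n = (b * y) * y.
  have -> : y * n = a * (x * y) + b * y * y + y * s by rewrite nE; ring.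
  by rewrite xy0 (yS s Ss) mulr0 add0r addr0.
have [xn0|xn0] := pselect (x * n = 0); last first.
  have [|r [rn Pr]] := meet x (x * n) px Px _ xn0.
    by rewrite xn; apply: (cyclicZ (a * x) (x : R^o)).
  by exists (r * x); rewrite -mulrA.
have [yn0|yn0] := pselect (y * n = 0); last first.
  have [|r [rn Pr]] := meet y (y * n) py Py _ yn0.
    by rewrite yn; apply: (cyclicZ (b * y) (y : R^o)).
  by exists (r * y); rewrite -mulrA.
have soc z c : pir z ->
    (forall c : R, c <> 0 -> cyclic (z : R^o) c ->
       exists p : R, [/\ cyclic (z : R^o) p, P p & p <> 0]) ->
    cyclic (z : R^o) c -> (forall m, M m -> m * c = 0) -> P c.
  move=> pz Pz zc Mc; have [->|c0] := pselect (c = 0); first exact: (submod0 hP).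
  have [r [rc Pr]] := meet z c pz Pz zc c0.
  have [|u ur] := @local_unit _ _ hM r; first by move=> /Mc.
  by rewrite -[c]mul1r -ur -mulrA; apply: (idealM u hP).
have Max : P (a * x).
  apply: soc Px (cyclicZ a (x : R^o)) _ => // m Mm.
  have [a' [b' [s' [Ss' ->]]]] := dec m Mm.
  have -> : (a' * x + b' * y + s') * (a * x)
    = a' * (a * x * x) + a * b' * (x * y) + a * (x * s') by ring.
  by rewrite -xn xn0 xy0 (xS s' Ss') !mulr0 !addr0.
have May : P (b * y).
  apply: soc Py (cyclicZ b (y : R^o)) _ => // m Mm.
  have [a' [b' [s' [Ss' ->]]]] := dec m Mm.
  have -> : (a' * x + b' * y + s') * (b * y)
    = b' * (b * y * y) + b * a' * (x * y) + b * (y * s') by ring.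
  by rewrite -yn yn0 xy0 (yS s' Ss') !mulr0 !addr0.
exists 1; rewrite mul1r; split=> //; rewrite nE.
by apply: (submodD hP); [apply: (submodD hP)|apply: SP].
Qed.

End Classification.

(** * Consequences of the decomposition of M for all ideals *)

Section Decompositions.
Variables (R : comPzRingType) (M : set R^o) (hM : local_ring_with M).
Implicit Types (I J K S T : set R^o) (a b c m r s x y z : R).
Let hMi := local_ideal hM.

Lemma two_PIR_formP (L : choiceType) I : ideal I ->
  two_PIR_form L I <-> exists (x y : R) (S : set R^o) (w : L -> R^o),
    [/\ ideal S, direct_sum (fun l => cyclic (w l)) S,
        forall l, simple (cyclic (w l)), tri x y S I & pir x /\ pir y].
Proof.
move=> hI; split.
  move=> [x [y [w [[/(sum_two_tri _ _ _ hI)[S [hS sumS triI]] simw]]]]].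
  by move=> /principal_ideal_ringP px /principal_ideal_ringP py; exists x, y, S, w.
move=> [x [y [S [w [hS sumS simw triI [px py]]]]]].
exists x, y, w; split; [split=> //|exact/principal_ideal_ringP..].
by apply/(sum_two_tri _ _ _ hI); exists S.
Qed.

Lemma semisimple_annihilated (L : choiceType) (w : L -> R^o) S :
  direct_sum (fun l => cyclic (w l)) S -> (forall l, simple (cyclic (w l))) ->
  forall m s, M m -> S s -> m * s = 0.
Proof.
move=> /direct_sumP[l|-> _ simw m s Mm]; first exact: submodule_cyclic.
apply: (@span_bigcup_sub _ _ _ _ _ [set s : R^o | m * (s : R) = 0]).
  apply/submoduleP; split; first exact: mulr0.
  move=> a u v /= mu mv; rewrite mulrDr mv addr0.
  have -> : m * (a *: u) = a * (m * (u : R)) by rewrite mulrCA.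
  by rewrite mu mulr0.
move=> l _ _ [a _ <-] /=; have [_ mw] := simple_cyclic hM (simw l).
have -> : m * (a *: w l) = a * (m * (w l : R)) by rewrite mulrCA.
by rewrite mw // mulr0.
Qed.

Lemma annihilated_semisimple S : ideal S ->
  (forall m s, M m -> S s -> m * s = 0) ->
  exists (L : choiceType) (w : L -> R^o),
    direct_sum (fun l => cyclic (w l)) S /\ forall l, simple (cyclic (w l)).
Proof.
move=> hS MS; apply: semisimple_basis => // r.
have [Mr|/(local_unit hM)] := pselect (M r); last by right.
by left=> s Ss; apply: MS.
Qed.

Lemma direct_sum_indep (L : choiceType) (w : L -> R^o) S :
  direct_sum (fun l => cyclic (w l)) S -> indep (fun l => cyclic (w l)).
Proof. by move=> /direct_sumP[l|//]; apply: submodule_cyclic. Qed.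

(** An ideal meeting each simple summand of [S] contains them all, hence contains [S]; this is the
    hypothesis of the exchange bound. *)
Lemma semisimple_card_le (L G : choiceType) (w : L -> R^o) (w' : G -> R^o) S T :
  direct_sum (fun l => cyclic (w l)) S -> (forall l, simple (cyclic (w l))) ->
  direct_sum (fun g => cyclic (w' g)) T -> (forall g, simple (cyclic (w' g))) ->
  T `<=` S -> [set: G] #<= [set: L].
Proof.
move=> sumS simw sumT simw' TS.
have hC (L' : Type) (u : L' -> R^o) l := submodule_cyclic (u l).
apply: (uniform_dimension_bound (hC _ w') (hC _ w) (T := S)).
- by move=> g v w'v; apply: TS; have [sub _ _ _] := direct_sum_isum g (hC _ w') sumT; apply: sub.
- move=> g; exists (w' g); split; first exact: cyclic_id.
  by have [] := simple_cyclic hM (simw' g).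
- exact: direct_sum_indep sumT.
move=> P n hP Sn n0 Pw; exists 1; rewrite scale1r; split=> //.
have [SE _] := (direct_sumP _ (hC _ w)).1 sumS; rewrite SE in Sn.
apply: (@span_bigcup_sub _ _ _ _ _ _ _ _ _ Sn) => // l _.
have [wl0 Mw] := simple_cyclic hM (simw l).
have [p [[a _ <-] Pp p0]] := Pw l _ (cyclic_id (w l)) wl0.
apply: cyclic_sub => //.
have [|u ua] := @local_unit _ _ hM a; first by move=> Ma; apply: p0; apply: Mw.
have -> : w l = u *: (a *: w l) by rewrite scalerA ua scale1r.
exact: (submodZ hP).
Qed.

Section Structure.
Variables (L : choiceType) (formM : two_PIR_form L M).

Lemma proper_ideal_structure I : ideal I -> I != [set: R^o] ->
  exists (n m : R) (G : choiceType) (w : G -> R^o) (T : set R^o),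
    [/\ ideal T, direct_sum (fun g => cyclic (w g)) T,
        forall g, simple (cyclic (w g)), tri n m T I
      & [/\ [set: G] #<= [set: L], two_gen n & pir n /\ pir m \/ m = 0]].
Proof.
move=> hI IT; have IM := proper_ideal_sub hM hI IT.
have [x [y [S [w [hS sumS simw triM [px py]]]]]] := (two_PIR_formP L hMi).1 formM.
have MS := semisimple_annihilated sumS simw.
have [n [m [triI nm]]] := ideal_classification hM hS triM MS px py hI IM.
have hIS : ideal (I `&` S) by apply: submoduleI.
have [|G [u [sumG simu]]] := annihilated_semisimple hIS.
  by move=> r s Mr [_ Ss]; apply: MS.
have In : I n by case: triI.
exists n, m, G, u, (I `&` S); split=> //; split=> //.
  by apply: semisimple_card_le sumS simw sumG simu _ => s [].
exact: (two_gen_max hM hS triM MS px py (IM _ In)).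
Qed.

Lemma proper_ideals_form_of_max : proper_ideals_form R L.
Proof.
move=> I hI IT.
have [n [m [G [w [T [hT sumT simw triI [cardG tn nm]]]]]]] :=
  proper_ideal_structure hI IT.
exists G; split=> //; case: nm => [pnm|m0].
  by left; apply/two_PIR_formP => //; exists n, m, T, w.
right; exists n, w; split; last exact: two_gen_ideals.
split=> //; rewrite m0 in triI.
have hC i := submodule_cyclic (oapp w (n : R^o) i).
apply/(direct_sum_option hC hI); exists T; split=> //.
have [T' [hT' T'E isumI]] := (triP _ _ hT hI).1 triI.
suff <- : T' = T by [].
move: T'E; rewrite cyclic0 => -[_ TT' dec _].
apply/seteqP; split=> // v /dec[_ [s [-> Ts ->]]].
by rewrite add0r.
Qed.

Lemma two_nonsimple_of_max I : ideal I -> direct_sum_cyclic_two_nonsimple I.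
Proof.
move=> hI; have [IT|/eqP IT] := pselect (I = [set: R^o]).
  (* The unit ideal is cyclic, generated by 1. *)
  exists unit, (fun _ => 1 : R^o); split; last first.
    apply: (@card_le_injective _ _ _ _ (fun=> 0)); first by move=> ? _.
    by move=> [] [].
  have hC (l : unit) := submodule_cyclic (1 : R^o).
  apply/direct_sumP => //; split.
    rewrite IT; apply/seteqP; split=> // r _.
    apply: (@span_bigcup_mem _ _ _ _ _ tt) => //.
    by exists r => //; apply: mulr1.
  move=> [] v _; rewrite (_ : \bigcup_(k in _) _ = set0) ?span0 //.
  by apply/seteqP; split=> // u [[]].
have [n [m [G [w [T [hT sumT simw triI _]]]]]] := proper_ideal_structure hI IT.
exists (option (option G)), (fun i => oapp (oapp w (m : R^o)) (n : R^o) i); split.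
  by apply/(sum_two_tri _ _ _ hI); exists T.
(* The value 2 falls on the simple summands only, so nonsimple indices land in [I_2]. *)
pose f (i : option (option G)) : nat := if i is Some j then if j is Some _ then 2 else 1 else 0.
apply: (@card_le_injective _ _ _ _ f).
  by move=> [[g|]|] //= /(_ (simw g)).
move=> [[g|]|] [[g'|]|] // /set_mem /= ng /set_mem /= ng' //.
Qed.

Lemma decompositions_bounded_of_max : decompositions_bounded R L.
Proof.
move=> I hI G N hN N0 sumI.
have Nn0 g : exists n, N g n /\ n <> 0.
  apply: contrapT => no; have /eqP := N0 g; apply; apply/seteqP.
  split=> [v Nv|_ ->]; last exact: (submod0 (hN g)).
  by apply: contrapT => v0; apply: no; exists v.
have [IE indN] := (direct_sumP _ hN).1 sumI.
have NI g : N g `<=` I by rewrite IE; apply: span_bigcup_mem.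
have [IT|/eqP IT] := pselect (I = [set: R^o]).
  (* A local ring is indecomposable: if all summands were proper they would lie in [M], and so would
     1. The other summands then meet the full one and cannot be nonzero, so there is just one
     index. *)
  have [g gT] : exists g, N g = [set: R^o].
    apply: contrapT => /forallNP NT; apply: (local1 hM).
    have : I 1 by rewrite IT.
    rewrite IE; apply: span_bigcup_sub => // g _.
    by apply: proper_ideal_sub => //; apply/eqP.
  have uniqG g' : g' = g.
    apply: contrapT => gg'; have [v [Nv]] := Nn0 g'; apply.
    apply: indN Nv _; apply: (@span_bigcup_mem _ _ _ _ _ g).
      by move=> /esym.
    by rewrite gT.
  apply: (@card_le_injective _ _ _ _ (fun=> None)) => // g1 g2 _ _ _.
  by rewrite (uniqG g1) (uniqG g2).
have IM := proper_ideal_sub hM hI IT.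
have [x [y [S [w [hS sumS simw triM [px py]]]]]] := (two_PIR_formP L hMi).1 formM.
have MS := semisimple_annihilated sumS simw.
pose u i := oapp (oapp w (y : R^o)) (x : R^o) i.
have hC i := submodule_cyclic (u i).
apply: (uniform_dimension_bound hN hC (T := M)) => //.
  by move=> g v /NI/IM.
move=> P n hP Mn n0 Pu.
have [|||r rn] := max_essential hM hS triM px py hP Mn n0; last by exists r.
- by move=> c c0 xc; apply: (Pu None c).
- by move=> c c0 yc; apply: (Pu (Some None) c).
- have [SE _] := (direct_sumP _ (fun l => submodule_cyclic (w l))).1 sumS.
  rewrite SE; apply: span_bigcup_sub => // l _.
  have [wl0 Mw] := simple_cyclic hM (simw l).
  have [p [[a _ <-] Pp p0]] := Pu (Some (Some l)) _ (cyclic_id (w l)) wl0.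
  apply: cyclic_sub => //.
  have [|v va] := @local_unit _ _ hM a; first by move=> Ma; apply: p0; apply: Mw.
  have -> : w l = v *: (a *: w l) by rewrite scalerA va scale1r.
  exact: (submodZ hP).
Qed.

End Structure.

(** The form is applied to [M], which is proper. In its second variant [z] is paired with [y = 0],
    and [pir z] comes from the power argument. The index type is the one attached to [M], whence
    only an inequality of cardinals. *)
Lemma max_of_proper_ideals_form (L : choiceType) : proper_ideals_form R L ->
  exists L' : choiceType, [set: L'] #<= [set: L] /\ two_PIR_form L' M.
Proof.
move=> formL; have MT : M != [set: R^o] by case: hM => -[].
have [G [cardG [|[z [w [[sumM simw] twoz]]]]]] := formL M hMi MT; exists G; split=> //.
have hC i := submodule_cyclic (oapp w (z : R^o) i).
have hCw l := submodule_cyclic (w l).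
have [S [sumS isumM]] := (direct_sum_option hC hMi).1 sumM.
have hS := direct_sum_submodule hCw sumS.
apply/two_PIR_formP => //; exists z, 0, S, w; split=> //.
  exact: isum_tri0.
split; last exact: pir0.
have [zM _ dec _] := isumM.
apply: (pir_cyclic_summands hM); [by apply: zM; apply: cyclic_id| |].
  move=> m /dec[_ [s [[a _ <-] Ss ->]]]; exists a.
  have sz : s * z = 0.
    rewrite mulrC; apply: (isum_disjoint_mul _ hS isumM) => //; last exact: cyclic_id.
    exact: submodule_cyclic.
  have -> : (a *: z + s) * z = a * (z * z) + (s : R) * z.
    by rewrite mulrA -mulrDl.
  by rewrite sz addr0.
exact: (ideals_sum_two_summands twoz).
Qed.

End Decompositions.

(** * Splitting the maximal ideal when ideals have cyclic summands *)

Section SummandsOfCyclics.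
Variables (R : comPzRingType) (M : set R^o) (hM : local_ring_with M).
Implicit Types (I J K S T : set R^o) (a b c m r s x y z : R).
Let hMi := local_ideal hM.

Hypothesis summands : forall I, ideal I -> forall m x, I x -> m * x <> 0 ->
  exists a J, [/\ I a, ideal J, isum (cyclic (a : R^o)) J I & m * a <> 0].

Section ThreeAxes.
Variables x y z : R.
Hypotheses (xy : x * y = 0) (xz : x * z = 0) (yz : y * z = 0).
Hypotheses (xx : x * x <> 0) (yy : y * y <> 0) (zz : z * z <> 0).
Variables (I J : set R^o) (a al be u : R).
Hypotheses (If : I (x + z)) (hJ : ideal J) (isumI : isum (cyclic (a : R^o)) J I).
Hypotheses (aE : a = al * (x + y) + be * (x + z)) (ual : u * al = 1).

(** Along each axis both [a] and the complementary part [j] of [x + z] are multiples of the same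
    square. Cross-multiplying the coefficients gives an element of [R a] and of [J], hence zero. *)
Lemma three_axes_unit_coef : False.
Proof.
have [_ _ dec dis] := isumI.
have [_ [j [[r _ <-] Jj fE]]] := dec _ If.
have {}fE : x + z = r * a + (j : R) := fE.
have jE : j = (1 - r * be) * (x + z) - r * al * (x + y).
  have -> : j = (x + z) - r * a by rewrite fE; ring.
  by rewrite aE; ring.
have meet c d : c * a = d * j -> c * a = 0.
  move=> cd; apply: dis; first exact: (cyclicZ c (a : R^o)).
  by rewrite cd; apply: (idealM d hJ).
have xa : x * a = (al + be) * (x * x) + al * (x * y) + be * (x * z) by rewrite aE; ring.
have ya : y * a = al * (y * y) + (al + be) * (x * y) + be * (y * z) by rewrite aE; ring.
have za : z * a = be * (z * z) + (al + be) * (x * z) + al * (y * z) by rewrite aE; ring.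
have xj : x * j = (1 - r * (al + be)) * (x * x) + (1 - r * be) * (x * z) - r * al * (x * y).
  by rewrite jE; ring.
have yj : y * j = - r * al * (y * y) + (1 - r * (al + be)) * (x * y) + (1 - r * be) * (y * z).
  by rewrite jE; ring.
have zj : z * j = (1 - r * be) * (z * z) + (1 - r * (al + be)) * (x * z) - r * al * (y * z).
  by rewrite jE; ring.
rewrite xy xz yz !mulr0 ?subr0 ?addr0 in xa ya za xj yj zj.
have unit0 c v w : w * c = 1 -> c * v = 0 -> v = 0.
  by move=> wc cv; rewrite -[v]mul1r -wc -mulrA cv mulr0.
(* On the y-axis the coefficients are [al] and [- r * al]; with [r] a unit this forces
   [y * y = 0]. *)
have Mr : M r.
  apply: contrapT => /(local_unit hM)[v vr]; apply: yy.
  apply: (unit0 al _ u) => //; rewrite -ya.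
  apply: (unit0 r _ v) => //; rewrite mulrA; apply: (meet _ (- y)).
  by rewrite mulNr yj -mulrA ya; ring.
have unit1 c : exists v, v * (1 - r * c) = 1.
  by apply: (local_subr1 hM); rewrite mulrC; apply: (idealM c hMi).
(* On the z-axis the coefficients are [be] and [1 - r * be], the latter a unit since [r] lies in
   [M]. A unit [be] would force [z * z = 0]; so [al + be] is a unit, and the x-axis gives the
   contradiction. *)
have Mbe : M be.
  apply: contrapT => /(local_unit hM)[v vbe]; apply: zz.
  have [d dr] := unit1 be.
  apply: (unit0 be _ v) => //; apply: (unit0 (1 - r * be) _ d) => //.
  rewrite -za mulrA; apply: (meet _ (be * z)).
  by rewrite -!mulrA za zj; ring.
have [v val] : exists v, v * (al + be) = 1.
  apply: (local_unit hM) => Malbe; apply: (local1 hM); rewrite -ual.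
  apply: (idealM u hMi); have -> : al = (al + be) - be by ring.
  exact: (submodB hMi).
have [d dr] := unit1 (al + be).
apply: xx; apply: (unit0 (al + be) _ v) => //.
apply: (unit0 (1 - r * (al + be)) _ d) => //.
rewrite -xa mulrA; apply: (meet _ ((al + be) * x)).
by rewrite -!mulrA xa xj; ring.
Qed.

End ThreeAxes.

Lemma no_three_axes x y z : x * y = 0 -> x * z = 0 -> y * z = 0 ->
  x * x <> 0 -> y * y <> 0 -> z * z <> 0 -> False.
Proof.
move=> xy xz yz xx yy zz.
pose I : set R^o := [set v | exists s t : R, v = s * (x + y) + t * (x + z)].
have hI : ideal I.
  apply/submoduleP; split; first by exists 0, 0; rewrite !mul0r addr0.
  move=> c _ _ [s [t ->]] [s' [t' ->]]; exists (c * s + s'), (c * t + t').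
  by rewrite -[c *: _]/(c * (s * (x + y) + t * (x + z))); ring.
have Ie : I (x + y) by exists 1, 0; ring.
have If : I (x + z) by exists 0, 1; ring.
have [|a [J [[al [be aE]] hJ isumI xa]]] := summands hI (m := x) Ie.
  by rewrite mulrDr xy addr0.
have [Mal|/(local_unit hM)[u ual]] := pselect (M al); last first.
  exact: (three_axes_unit_coef xy xz yz xx yy zz If hJ isumI aE ual).
have [Mbe|/(local_unit hM)[u ube]] := pselect (M be); last first.
  have aE' : a = be * (x + z) + al * (x + y) by rewrite aE addrC.
  rewrite mulrC in yz.
  exact: (three_axes_unit_coef xz xy yz xx zz yy Ie hJ isumI aE' ube).
have [_ _ dec dis] := isumI.
have [_ [j [[r _ <-] Jj eE]]] := dec _ Ie.
have [_ [k [[s _ <-] Jk fE]]] := dec _ If.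
have {}eE : x + y = r * a + (j : R) := eE.
have {}fE : x + z = s * a + (k : R) := fE.
apply: xa; suff -> : a = 0 by rewrite mulr0.
(* With both coefficients in [M], substituting the decompositions of [x + y] and [x + z] into [a]
   shows that [a - (al * r + be * s) * a] lies in [R a] and in [J], so it vanishes. *)
apply: (@local_nakayama _ _ hM (al * r + be * s)).
  apply: (submodD hMi).
    by rewrite mulrC; apply: (idealM r hMi).
  by rewrite mulrC; apply: (idealM s hMi).
apply/eqP; rewrite -subr_eq0; apply/eqP.
have -> : a - (al * r + be * s) * a = (1 - (al * r + be * s)) * a by ring.
apply: dis; first exact: (cyclicZ _ (a : R^o)).
have -> : (1 - (al * r + be * s)) * a = al * j + be * k.
  have -> : (1 - (al * r + be * s)) * a = a - (al * r + be * s) * a by ring.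
  by rewrite {1}aE eE fE; ring.
by apply: (submodD hJ); [apply: (idealM al hJ)|apply: (idealM be hJ)].
Qed.

Lemma cyclic_summands_all x : cyclic_summands x.
Proof.
move=> K hK _ v Kv v0.
have [|a [J [_ hJ isumK a0]]] := summands hK (m := 1) Kv; first by rewrite mul1r.
by exists a, J; split=> //; rewrite -[a]mul1r.
Qed.

Lemma pir_of_square z : M z -> (forall m, M m -> exists a, m * z = a * (z * z)) -> pir z.
Proof. by move=> Mz Mzz; apply: (pir_cyclic_summands hM Mz Mzz (@cyclic_summands_all z)). Qed.

(** The complement [T] annihilates [z], so only the [R z]-part of [m] acts on it. *)
Lemma isum_square z T I m : ideal I -> ideal T -> isum (cyclic (z : R^o)) T I ->
  I m -> exists a, m * z = a * (z * z).
Proof.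
move=> hI hT isumI; have [_ _ dec _] := isumI.
move=> /dec[_ [s [[a _ <-] Ts ->]]]; exists a.
have sz : (s : R) * z = 0.
  rewrite mulrC; apply: (isum_disjoint_mul _ hT isumI) => //; last exact: cyclic_id.
  exact: submodule_cyclic.
have -> : (a *: (z : R^o) + s) * z = a * (z * z) + (s : R) * z.
  by rewrite mulrA -mulrDl.
by rewrite sz addr0.
Qed.

Lemma square_neq0 z m : M m -> m * z <> 0 ->
  (forall m, M m -> exists a, m * z = a * (z * z)) -> z * z <> 0.
Proof. by move=> Mm mz Mzz zz; have [a] := Mzz m Mm; rewrite zz mulr0. Qed.

Lemma max_two_PIR_form : exists L : choiceType, two_PIR_form L M.
Proof.
suff [x [y [S [hS triM MS [px py]]]]] : exists (x y : R) (S : set R^o),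
    [/\ ideal S, tri x y S M, forall m s, M m -> S s -> m * s = 0 & pir x /\ pir y].
  have [L [w [sumS simw]]] := annihilated_semisimple hM hS MS.
  by exists L; apply/two_PIR_formP => //; exists x, y, S, w.
(* Either [M] kills [T], which is then semisimple, or a cyclic summand not killed by [M] can be
   split off. *)
have split_off T : ideal T -> T `<=` M ->
    (forall m s, M m -> T s -> m * s = 0) \/
    exists z T', [/\ M z, ideal T', isum (cyclic (z : R^o)) T' T
      & exists m, M m /\ m * z <> 0].
  move=> hT TM; have [[m [t [Mm [Tt mt]]]]|no] := pselect
      (exists m t, M m /\ (T t /\ m * t <> 0)).
    right; have [z [T' [Tz hT' isumT mz]]] := summands hT Tt mt.
    by exists z, T'; split=> //; [apply: TM|exists m].
  left=> m s Mm Ts; apply: contrapT => ms; apply: no.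
  by exists m, s.
have [MM|[x [M1 [Mx hM1 isum1 [m1 [Mm1 mx]]]]]] := split_off M hMi (fun _ => id).
  exists 0, 0, M; split=> //; last by split; apply: pir0.
  apply: isum_tri0 => //; rewrite cyclic0; split=> // [_ ->|v Mv].
  - exact: (submod0 hMi).
  - by exists 0, v; rewrite add0r.
have Mxx m (Mm : M m) := isum_square hMi hM1 isum1 Mm.
have xx := square_neq0 Mm1 mx Mxx.
have px := pir_of_square Mx Mxx.
have [_ M1M dec1 _] := isum1.
have hCx := submodule_cyclic (x : R^o).
have xM1 t : M1 t -> x * t = 0.
  by apply: (isum_disjoint_mul hCx hM1 isum1); apply: cyclic_id.
have [MM1|[y [M2 [My hM2 isum2 [m2 [Mm2 my]]]]]] := split_off M1 hM1 M1M.
  exists x, 0, M1; split=> //; first exact: isum_tri0.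
  by split=> //; apply: pir0.
have [yM1 M2M1 dec2 _] := isum2.
have M1y : M1 y by apply: yM1; apply: cyclic_id.
(* The relation holds a priori only over the complement containing [z]. It extends to all of [M]
   because [x] annihilates [M1]. *)
have lift z : M1 z -> (forall t, M1 t -> exists a, t * z = a * (z * z)) ->
    forall m, M m -> exists a, m * z = a * (z * z).
  move=> M1z M1zz m /dec1[_ [t [[b _ <-] M1t ->]]].
  have [a ta] := M1zz t M1t; exists a; rewrite -ta.
  have -> : (b *: (x : R^o) + t) * z = b * (x * z) + (t : R) * z.
    by rewrite mulrA -mulrDl.
  by rewrite xM1 // mulr0 add0r.
have Myy := lift y M1y (fun t M1t => isum_square hM1 hM2 isum2 M1t).
have yy := square_neq0 Mm2 my Myy.
have py := pir_of_square My Myy.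
have triM : tri x y M2 M by apply/triP => //; exists M1.
have M2M : M2 `<=` M by move=> t /M2M1/M1M.
have [MM2|[z [M3 [Mz hM3 isum3 [m3 [Mm3 mz]]]]]] := split_off M2 hM2 M2M.
  by exists x, y, M2.
have [zM2 M3M2 _ _] := isum3.
have M2z : M2 z by apply: zM2; apply: cyclic_id.
have hCy := submodule_cyclic (y : R^o).
have yM2 t : M2 t -> y * t = 0.
  by apply: (isum_disjoint_mul hCy hM2 isum2); apply: cyclic_id.
have M1zz t : M1 t -> exists a, t * z = a * (z * z).
  move=> /dec2[_ [s [[b _ <-] M2s ->]]].
  have [a sa] := isum_square hM2 hM3 isum3 M2s; exists a; rewrite -sa.
  have -> : (b *: (y : R^o) + s) * z = b * (y * z) + (s : R) * z.
    by rewrite mulrA -mulrDl.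
  by rewrite yM2 // mulr0 add0r.
have Mzz := lift z (M2M1 _ M2z) M1zz.
have zz := square_neq0 Mm3 mz Mzz.
by case: (no_three_axes (xM1 _ M1y) (xM1 _ (M2M1 _ M2z)) (yM2 _ M2z) xx yy zz).
Qed.

End SummandsOfCyclics.

Theorem theorem3p7 (R : comPzRingType) (M : set R^o) (hM : local_ring_with M) :
  [<-> forall I : set R^o, ideal I -> direct_sum_cyclic I;
       forall I : set R^o, ideal I -> direct_sum_cyclic_two_nonsimple I;
       exists L : choiceType, two_PIR_form L M;
       exists L : choiceType, proper_ideals_form R L;
       forall I : set R^o, ideal I -> summand_of_direct_sum_cyclic I]
  /\ [/\ forall L : choiceType, two_PIR_form L M -> proper_ideals_form R L,
         forall L : choiceType, proper_ideals_form R L ->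
           exists L' : choiceType,
             [set: L'] #<= [set: L] /\ two_PIR_form L' M
       & forall L : choiceType,
           two_PIR_form L M \/ proper_ideals_form R L ->
           decompositions_bounded R L].
Proof.
have h21 : (forall I : set R^o, ideal I -> direct_sum_cyclic_two_nonsimple I) ->
    forall I : set R^o, ideal I -> direct_sum_cyclic I.
  by move=> h I /h[L [w [sumI _]]]; exists L, w.
have h15 : (forall I : set R^o, ideal I -> direct_sum_cyclic I) ->
    forall I : set R^o, ideal I -> summand_of_direct_sum_cyclic I.
  by move=> h I hI; apply: direct_sum_cyclic_summand => //; apply: h.
have h53 : (forall I : set R^o, ideal I -> summand_of_direct_sum_cyclic I) ->
    exists L : choiceType, two_PIR_form L M.
  move=> h; apply: (max_two_PIR_form hM) => I hI m x Ix mx.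
  exact: cyclic_summand (local_dichotomy hM) hI (h I hI) Ix mx.
have h32 : (exists L : choiceType, two_PIR_form L M) ->
    forall I : set R^o, ideal I -> direct_sum_cyclic_two_nonsimple I.
  by move=> [L formM] I; apply: (two_nonsimple_of_max hM formM).
have h43 : (exists L : choiceType, proper_ideals_form R L) ->
    exists L : choiceType, two_PIR_form L M.
  by move=> [L /(max_of_proper_ideals_form hM)[L' [_ formM]]]; exists L'.
split; first tfae.
- by move=> /h15/h53/h32.
- by move=> /h21/h15/h53.
- by move=> [L formM]; exists L; apply: (proper_ideals_form_of_max hM).
- by move=> /h43/h32/h21/h15.
- by move=> /h53/h32/h21.
split.
- exact: (proper_ideals_form_of_max hM).
- exact: (max_of_proper_ideals_form hM).
move=> L [formM|/(max_of_proper_ideals_form hM)[L' [cardL' formM]]].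
  exact: (decompositions_bounded_of_max hM formM).
(* The bound is obtained for the index type [L'] attached to [M], then enlarged along an injection
   into [L]. *)
move=> I hI G N hN N0 sumI.
have := decompositions_bounded_of_max hM formM hI hN N0 sumI.
have [f injf] := injective_card_le cardL'.
move=> /card_le_trans; apply.
apply: (@card_le_injective _ _ _ _ (omap (omap f))) => //.
by move=> [[a|]|] [[b|]|] _ _ //= [] /injf ->.
Qed.
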